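(* Let $A:[0,\infty)\to\mathbb R^{d\times d}$ be locally integrable and bounded, and suppose that the equation $\dot x=A(t)x$ is diagonalizable, i.e. it is kinematically similar to a (nonautonomous) diagonal system $\dot y=\mathrm{diag}(a_1(t),\dots,a_d(t))\,y$. Then the Bohl spectrum and the Sacker--Sell spectrum of $\dot x=A(t)x$ coincide. In particular, both spectra coincide for bounded one-dimensional systems.
   Context: All coefficient functions are locally integrable on $[0,\infty)$. Two equations $\dot x=A(t)x$ and $\dot y=B(t)y$ on $[0,\infty)$ are kinematically similar if there is a continuously differentiable function $S:[0,\infty)\to\mathbb R^{d\times d}$ with invertible values such that $S$ and $S^{-1}$ are bounded and $\dot S(t)=A(t)S(t)-S(t)B(t)$ for all $t\ge0$. Let $X(t)$ be the fundamental matrix of $\dot x=A(t)x$ with $X(0)=\mathds 1$ (identity matrix), and $\overline{\mathbb R}=\mathbb R\cup\{-\infty,\infty\}$. Bohl spectrum: for $\xi\in\mathbb R^d\setminus\{0\}$, $\Sigma_\xi$ is the set of all $\lambda\in\overline{\mathbb R}$ for which there are sequences $t_n,s_n\in[0,\infty)$ with $t_n-s_n\to\infty$ and $\lim_{n\to\infty}\frac1{t_n-s_n}\ln\frac{\|X(t_n)\xi\|}{\|X(s_n)\xi\|}=\lambda$; $\Sigma_{\rm Bohl}=\bigcup_{\xi\neq0}\Sigma_\xi$. Exponential dichotomy: the equation admits an exponential dichotomy with growth rate $\gamma\in\mathbb R$ if there are a projector $P\in\mathbb R^{d\times d}$ and constants $K\ge1$, $\alpha>0$ with $\|X(t)PX^{-1}(s)\|\le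 Ke^{(\gamma-\alpha)(t-s)}$ for all $0\le s\le t$ and $\|X(t)(\mathds 1-P)X^{-1}(s)\|\le Ke^{(\gamma+\alpha)(t-s)}$ for all $0\le t\le s$. It admits an exponential dichotomy with growth rate $\infty$ (respectively $-\infty$) if for some $\gamma\in\mathbb R$ it admits one with growth rate $\gamma$ and $P=\mathds 1$ (respectively $P=0$). Sacker--Sell spectrum: $\Sigma_{\rm SS}$ is the set of $\gamma\in\overline{\mathbb R}$ such that the equation does not admit an exponential dichotomy with growth rate $\gamma$. *)

(* Defs.v *)
From HB Require Import structures.
From mathcomp Require Import all_boot all_order all_algebra.
From mathcomp Require Import all_classical all_reals all_analysis.

Set Implicit Arguments.
Unset Strict Implicit.
Unset Printing Implicit Defensive.

Import Order.TTheory GRing.Theory Num.Theory numFieldNormedType.Exports.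

Local Open Scope classical_set_scope.
Local Open Scope ring_scope.

(* Functions on the half-line [0, oo) are represented by total functions on R;
   every definition below only uses their values at nonnegative times.

   The norm on vectors and matrices is MathComp-Analysis's maximum-of-entries
   norm; by equivalence of norms in finite dimension, all the notions below
   would be the same for any other choice. *)

Section LinearSystems.
Context {R : realType}.

Definition halfline : set R := `[0, +oo[.

(* The library's [locally_integrable] requires an open domain, and its
   [lebesgue_measure] lives on the Borel sigma-algebra; the completed measure is
   used so that coefficients only need to be Lebesgue measurable. *)
Definition loc_integrable_mx m n (A : R -> 'M[R]_(m, n)) : Prop :=
  forall (T : R) i j, 0 <= T ->
    (@completed_lebesgue_measure R).-integrable `[0, T] (fun t => (A t i j)%:E).

Definition bounded_mx m n (A : R -> 'M[R]_(m, n)) : Prop :=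
  [bounded A t | t in halfline].

(* Since A is only locally integrable, solutions are meant in the sense of
   Caratheodory: X is the fundamental matrix of x' = A(t) x with X(0) = 1 when
   it is continuous and X(t) = 1 + \int_0^t A(s) X(s) ds. *)
Definition is_fundamental_matrix d (A X : R -> 'M[R]_d) : Prop :=
  {within halfline, continuous X} /\
  forall (t : R) (i j : 'I_d), 0 <= t ->
    X t i j = (1%:M : 'M[R]_d) i j
      + \int[@completed_lebesgue_measure R]_(s in `[0, t]) (A s *m X s) i j.

(* The limit is taken inside [0, oo), so the derivative is one-sided at 0. *)
Definition is_C1_with_derivative m n (S dS : R -> 'M[R]_(m, n)) : Prop :=
  (forall t : R, 0 <= t ->
     (x - t)^-1 *: (S x - S t) @[x --> within halfline (t^')] --> dS t) /\
  {within halfline, continuous dS}.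

Definition kinematically_similar d (A B : R -> 'M[R]_d) : Prop :=
  exists S dS : R -> 'M[R]_d,
    [/\ is_C1_with_derivative S dS,
        (forall t, 0 <= t -> S t \in unitmx),
        bounded_mx S,
        bounded_mx (fun t => invmx (S t)) &
        forall t, 0 <= t -> dS t = A t *m S t - S t *m B t].

Definition diagonalizable_system d (A : R -> 'M[R]_d) : Prop :=
  exists a : R -> 'rV[R]_d,
    loc_integrable_mx a /\ kinematically_similar A (fun t => diag_mx (a t)).

Section Spectra.
Context {d : nat}.
(* X plays the role of the fundamental matrix. *)
Implicit Type X : R -> 'M[R]_d.

Definition Bohl_spectrum_at X (xi : 'cV[R]_d) : set (\bar R) :=
  [set lambda | exists t s : nat -> R,
    [/\ (forall n, 0 <= t n), (forall n, 0 <= s n),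
        t n - s n @[n --> \oo] --> +oo &
        ((t n - s n)^-1 * ln (`|X (t n) *m xi| / `|X (s n) *m xi|))%:E
          @[n --> \oo] --> lambda]].

Definition Bohl_spectrum X : set (\bar R) :=
  \bigcup_(xi in [set xi : 'cV[R]_d | xi != 0]) Bohl_spectrum_at X xi.

Definition exp_dichotomy_with_projector X (gamma : R) (P : 'M[R]_d) : Prop :=
  P *m P = P /\
  exists K alpha : R,
    [/\ 1 <= K, 0 < alpha,
        (forall s t, 0 <= s -> s <= t ->
           `|X t *m P *m invmx (X s)| <= K * expR ((gamma - alpha) * (t - s))) &
        (forall t s, 0 <= t -> t <= s ->
           `|X t *m (1%:M - P) *m invmx (X s)|
             <= K * expR ((gamma + alpha) * (t - s)))].

Definition exp_dichotomy X (g : \bar R) : Prop :=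
  match g with
  | gamma%:E => exists P, exp_dichotomy_with_projector X gamma P
  | +oo%E => exists gamma, exp_dichotomy_with_projector X gamma 1%:M
  | -oo%E => exists gamma, exp_dichotomy_with_projector X gamma 0
  end.

Definition SackerSell_spectrum X : set (\bar R) :=
  [set g | ~ exp_dichotomy X g].

End Spectra.
End LinearSystems.

(* Main.v *)
Require Import Defs.
From HB Require Import structures.
From mathcomp Require Import all_boot all_order all_algebra.
From mathcomp Require Import all_classical all_reals all_analysis.
From mathcomp Require Import measurable_realfun.
From mathcomp Require Import ring lra.

Set Implicit Arguments.
Unset Strict Implicit.
Unset Printing Implicit Defensive.

Import Order.TTheory GRing.Theory Num.Theory numFieldNormedType.Exports.

Local Open Scope classical_set_scope.
Local Open Scope ring_scope.

(** Both inclusions compare the growth of [|X t *m xi|] with exponentials.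

    For the inclusion of the Bohl spectrum in the Sacker--Sell spectrum, consider
    a dichotomy at rate [gamma] with projector [P].  A solution starting in the
    image of [P] grows at rate at most [gamma - alpha] on every interval.  Any
    other solution is eventually dominated by its unstable component, so up to a
    constant factor it grows at rate at least [gamma + alpha] on every interval
    ([dichotomy_stable], [dichotomy_unstable]).  Either way the Bohl exponents of
    that solution keep away from [gamma].

    The converse uses the diagonal form.  With [b_i] the integral of [a_i] and
    [D t] the diagonal matrix of the [exp (b_i t)], both [X t] and
    [S t *m D t *m invmx (S 0)] are Caratheodory solutions with the same initial
    value, so they are equal ([diagonal_form]).  As [S] and its inverse are
    bounded, the solution starting at the [i]-th column of [S 0] grows like
    [exp (b_i t)], and the averages [(b_i t - b_i s) / (t - s)] have the same
    limits as the Bohl quotients of that solution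
    ([exponent_limit_in_Bohl]).  If [gamma] is not a Bohl exponent then, the
    set of pairs with [t - s >= T] being connected, the intermediate value
    theorem puts the averages of [b_i] over all long intervals on one side of
    [gamma], at a distance bounded below ([scalar_dichotomy]).  Projecting onto
    the indices on the lower side gives a dichotomy at [gamma]
    ([dichotomy_of_not_Bohl]).  The rates [-oo] and [+oo] belong to neither
    spectrum, because a bounded coefficient bounds the growth of the transition
    matrix in both time directions ([solution_growth]).

    Since the coefficients are only integrable, solutions need not be
    differentiable everywhere; the product and chain rules are needed in
    integral form.  They follow from one principle: two functions agree up to a
    constant as soon as their increments over [s, t] differ by [O((t - s)^2)]
    ([const_of_quadratic_increments]). *)

(** * Integration on the half-line *)

Section CompletedIntegral.
Context {R : realType}.
Notation mu := (@completed_lebesgue_measure R).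
Notation completedR := (caratheodory_type (wlength (@idfun R))^*%mu).
Implicit Types (f g E : R -> R) (s t T : R).

(** Precomposing with the retraction [Num.max 0] turns continuity relative to the
    half-line into continuity on the whole line, where the usual calculus applies. *)
Definition half_cont f := continuous (fun x : R => f (Num.max 0 x)).

Lemma half_contP f : half_cont f <-> {within halfline, continuous f}.
Proof.
rewrite subspace_continuousP /halfline; split => [cf x|cf x].
  rewrite /= in_itv/= andbT => x0.
  have := cf x; rewrite /continuous_at /= max_r// => h.
  apply: (@cvg_trans _
    ((fun y : R => f (Num.max 0 y)) @ within `[0, +oo[%classic (nbhs x))).
    apply: near_eq_cvg; rewrite near_withinE; near=> y.
    by rewrite /= in_itv/= andbT => y0; rewrite max_r.
  exact: cvg_within_filter.
have m0 : `[0, +oo[%classic (Num.max 0 x) by rewrite /= in_itv/= andbT le_max lexx.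
apply: (cvg_comp (fun y : R => Num.max 0 y) f _ (cf _ m0)) => P wP.
have pc : continuous (fun y : R => Num.max 0 y).
  by move=> y; apply: continuous_max; [exact: cvg_cst|exact: cvg_id].
have : nbhs x [set y | `[0, +oo[%classic (Num.max 0 y) -> P (Num.max 0 y)].
  exact: (pc x [set z | `[0, +oo[%classic z -> P z] wP).
apply: filterS => y; apply.
by rewrite /= in_itv/= andbT le_max lexx.
Unshelve. all: by end_near. Qed.

(** The retraction [Num.max 0] is 1-Lipschitz, so [E (Num.max 0 x)] has derivative
    zero on the whole line, also at the boundary point. *)
Lemma const_of_zero_slope E :
  (forall t, 0 <= t -> forall e : R, 0 < e ->
     \forall s \near t, 0 <= s -> `|E s - E t| <= e * `|s - t|) ->
  forall t, 0 <= t -> E t = E 0.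
Proof.
move=> H t t0.
pose p x : R := Num.max 0 x; pose F x := E (p x).
have pL x y : `|p y - p x| <= `|y - x|.
  rewrite /p; case: (leP 0 y) => y0; case: (leP 0 x) => x0 //.
  - rewrite subr0 !ger0_norm ?subr_ge0 ?(le_trans (ltW x0))//.
    by rewrite lerBrDl -lerBrDr subrr ltW.
  - rewrite sub0r normrN ger0_norm// distrC ger0_norm ?subr_ge0.
      by rewrite lerBrDl -lerBrDr subrr ltW.
    exact: le_trans (ltW y0) x0.
  - by rewrite subrr normr0 normr_ge0.
have p0 x : 0 <= p x by rewrite le_max lexx.
have pc : continuous p.
  by move=> y; apply: continuous_max; [exact: cvg_cst|exact: cvg_id].
have FE x : 0 <= x -> F x = E x by move=> x0; rewrite /F /p max_r.
rewrite -FE// -(FE 0)//; apply: is_derive_0_is_cst => x.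
have D : h^-1 *: (F (h *: (1:R) + x) - F x) @[h --> 0^'] --> (0 : R).
  apply/cvgrPdist_le => e e0.
  have := H _ (p0 x) _ e0.
  move/(pc x); rewrite nbhs_simpl /= => H1.
  have H2 : \forall h \near (0:R), 0 <= p (h + x) ->
      `|E (p (h + x)) - E (p x)| <= e * `|p (h + x) - p x|.
    have : (fun h : R => h + x) @ 0 --> x.
      have : (fun h : R => h + x) @ 0 --> 0 + x.
        by apply: cvgD; [exact: cvg_id|exact: cvg_cst].
      by rewrite add0r.
    by move=> /(_ _ H1).
  rewrite near_withinE; near=> h => h0.
  rewrite sub0r normrN normrM normfV ler_pdivrMl ?normr_gt0//.
  have -> : h *: (1 : R) = h by rewrite /GRing.scale/= mulr1.
  have h2 : 0 <= p (h + x) ->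
      `|E (p (h + x)) - E (p x)| <= e * `|p (h + x) - p x| by near: h.
  rewrite /F (le_trans (h2 (p0 _)))// mulrC ler_wpM2r ?(ltW e0)//.
  by rewrite (le_trans (pL _ _))// addrK.
by apply: DeriveDef; [apply/cvg_ex; exists 0; exact: D|exact: cvg_lim D].
Unshelve. all: by end_near. Qed.

(** This replaces almost-everywhere differentiation below: the product and chain
    rules in integral form reduce to a quadratic estimate of an error term. *)
Lemma const_of_quadratic_increments E :
  (forall T, 0 <= T -> exists C, forall s t, 0 <= s -> s <= t -> t <= T ->
     `|E t - E s| <= C * (t - s) ^+ 2) ->
  forall t, 0 <= t -> E t = E 0.
Proof.
move=> H; apply: const_of_zero_slope => t t0 e e0.
have [C HC] := H (t + 1) (addr_ge0 t0 ler01).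
pose C' := Num.max 1 C.
have C'0 : 0 < C' by rewrite lt_max ltr01.
have HC' a b : 0 <= a -> a <= b -> b <= t + 1 -> `|E b - E a| <= C' * (b - a) ^+ 2.
  move=> a0 ab bt; apply: (le_trans (HC _ _ a0 ab bt)).
  by rewrite ler_wpM2r ?sqr_ge0// le_max lexx orbT.
have d0 : 0 < Num.min 1 (e / C') by rewrite lt_min ltr01 divr_gt0.
near=> s => s0.
have st : `|s - t| < Num.min 1 (e / C').
  by rewrite distrC; near: s; exact: nbhsx_ballx d0.
move: st; rewrite lt_min ltr_pdivlMr// => /andP[st1 st2].
have key : `|E s - E t| <= C' * `|s - t| ^+ 2.
  have [ts|st] := leP t s.
    rewrite real_normK ?num_real//; apply: HC' => //.
    by move: st1; rewrite ger0_norm ?subr_ge0// ltrBlDl => /ltW.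
  rewrite distrC [`|s - t|]distrC real_normK ?num_real//; apply: HC' => //.
  exact: ltW.
  by rewrite lerDl.
apply: (le_trans key); rewrite expr2 mulrA ler_wpM2r ?normr_ge0//.
by rewrite mulrC ltW.
Unshelve. all: by end_near. Qed.

(** The class of integrands used throughout.  Boundedness of the coefficient makes
    all integrands locally bounded, and this class, unlike that of locally
    integrable functions, is stable under products. *)
Definition loc_bdd_meas f := forall T, 0 <= T ->
  measurable_fun (`[0, T]%classic : set completedR) f /\
  exists M, forall t, 0 <= t -> t <= T -> `|f t| <= M.

Lemma measurable_itv_completed (i : interval R) :
  measurable ([set` i] : set completedR).
Proof. apply: sub_caratheodory; exact: measurable_itv. Qed.

Lemma completed_lebesgue_measure_itvcc s t : s <= t -> mu `[s, t] = (t - s)%:E.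
Proof.
move=> st; have := @lebesgue_measure_itv R `[s, t] => /= h.
transitivity (lebesgue_measure (`[s, t]%classic : set R)); first by [].
rewrite h /= lte_fin; case: ltP => //.
by move=> ts; have -> : s = t by [apply/eqP; rewrite eq_le st]; rewrite subrr.
Qed.

Lemma loc_bdd_meas_integrable f s t : loc_bdd_meas f -> 0 <= s -> s <= t ->
  mu.-integrable `[s, t] (EFin \o f).
Proof.
move=> bf s0 st; have [mf [M HM]] := bf _ (le_trans s0 st).
apply: (@integrableS _ _ _ mu `[0, t]%classic).
- exact: measurable_itv_completed.
- exact: measurable_itv_completed.
- by apply: subset_itvr; rewrite bnd_simp.
apply: measurable_bounded_integrable => //.
- exact: measurable_itv_completed.
- by rewrite [ltLHS]completed_lebesgue_measure_itvcc ?ltry//; exact: le_trans st.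
- exists M; split; first exact: num_real.
  move=> x Mx y /=; rewrite in_itv/= => /andP[y0 yt].
  by rewrite (le_trans (HM _ y0 yt))// ltW.
Qed.

Lemma eq_loc_bdd_meas f g : (forall t, 0 <= t -> f t = g t) ->
  loc_bdd_meas f -> loc_bdd_meas g.
Proof.
move=> fg bf T T0; have [mf [M HM]] := bf T T0; split.
  apply: eq_measurable_fun mf => x; rewrite inE/= in_itv/= => /andP[x0 _].
  exact: fg.
by exists M => t t0 tT; rewrite -fg//; exact: HM.
Qed.

Lemma loc_bdd_measD f g : loc_bdd_meas f -> loc_bdd_meas g ->
  loc_bdd_meas (fun t => f t + g t).
Proof.
move=> bf bg T T0; have [mf [M HM]] := bf T T0; have [mg [N HN]] := bg T T0.
split; first exact: measurable_funD.
exists (M + N) => t t0 tT.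
by rewrite (le_trans (ler_normD _ _))// lerD// ?HM ?HN.
Qed.

Lemma loc_bdd_measM f g : loc_bdd_meas f -> loc_bdd_meas g ->
  loc_bdd_meas (fun t => f t * g t).
Proof.
move=> bf bg T T0; have [mf [M HM]] := bf T T0; have [mg [N HN]] := bg T T0.
split; first exact: measurable_funM.
exists (M * N) => t t0 tT.
by rewrite normrM ler_pM ?normr_ge0// ?HM ?HN.
Qed.

Lemma loc_bdd_meas_cst c : loc_bdd_meas (fun=> c).
Proof.
move=> T T0; split; first exact: measurable_cst.
by exists `|c|.
Qed.

Lemma loc_bdd_measN f : loc_bdd_meas f -> loc_bdd_meas (fun t => - f t).
Proof.
move=> bf; apply: (@eq_loc_bdd_meas (fun t => -1 * f t)) => [t _|].
  by rewrite mulN1r.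
by apply: loc_bdd_measM => //; exact: loc_bdd_meas_cst.
Qed.

Lemma loc_bdd_measB f g : loc_bdd_meas f -> loc_bdd_meas g ->
  loc_bdd_meas (fun t => f t - g t).
Proof. by move=> bf bg; apply: loc_bdd_measD => //; exact: loc_bdd_measN. Qed.

Lemma loc_bdd_meas_sum (I : Type) (r : seq I) (F : I -> R -> R) :
  (forall i, loc_bdd_meas (F i)) -> loc_bdd_meas (fun t => \sum_(i <- r) F i t).
Proof.
move=> bF; elim: r => [|i r IH].
  by apply: eq_loc_bdd_meas (loc_bdd_meas_cst 0) => t _; rewrite big_nil.
apply: eq_loc_bdd_meas (loc_bdd_measD (bF i) IH) => t _.
by rewrite big_cons.
Qed.

Lemma half_cont_bounded f T : 0 <= T -> half_cont f ->
  exists M, forall t, 0 <= t -> t <= T -> `|f t| <= M.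
Proof.
move=> T0 cf.
have [|c _ Hc] := @EVT_max R (fun x => `|f (Num.max 0 x)|) 0 T T0.
  apply: continuous_subspaceT => x; apply: cvg_norm; exact: cf.
exists (`|f (Num.max 0 c)|) => t t0 tT.
by have := Hc t; rewrite in_itv/= t0 tT max_r//; apply.
Qed.

Lemma half_cont_loc_bdd_meas f : half_cont f -> loc_bdd_meas f.
Proof.
move=> cf T T0; split; last exact: half_cont_bounded.
suff : measurable_fun (`[0, T]%classic : set completedR)
    (fun x : R => f (Num.max 0 x)).
  apply: eq_measurable_fun => x; rewrite inE/= in_itv/= => /andP[x0 _].
  by rewrite max_r.
have mf : measurable_fun setT (fun x : R => f (Num.max 0 x)).
  exact: continuous_measurable_fun.
move=> _ Y mY; apply: measurableI; first exact: measurable_itv_completed.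
have := mf measurableT Y mY; rewrite setTI => h; exact: sub_caratheodory.
Qed.

Definition primitive f t : R := \int[mu]_(s in `[0, t]) f s.

Lemma primitiveD f g t : 0 <= t -> loc_bdd_meas f -> loc_bdd_meas g ->
  primitive (fun s => f s + g s) t = primitive f t + primitive g t.
Proof.
move=> t0 bf bg; apply: RintegralD; first exact: measurable_itv_completed.
  exact: loc_bdd_meas_integrable.
exact: loc_bdd_meas_integrable.
Qed.

Lemma primitiveZ c f t : 0 <= t -> loc_bdd_meas f ->
  primitive (fun s => c * f s) t = c * primitive f t.
Proof.
move=> t0 bf; apply: RintegralZl; first exact: measurable_itv_completed.
exact: loc_bdd_meas_integrable.
Qed.

Lemma primitiveB f g t : 0 <= t -> loc_bdd_meas f -> loc_bdd_meas g ->
  primitive (fun s => f s - g s) t = primitive f t - primitive g t.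
Proof.
move=> t0 bf bg; apply: RintegralB; first exact: measurable_itv_completed.
  exact: loc_bdd_meas_integrable.
exact: loc_bdd_meas_integrable.
Qed.

Lemma eq_primitive f g t : (forall s, 0 <= s -> f s = g s) ->
  primitive f t = primitive g t.
Proof.
move=> fg; apply: eq_Rintegral => x; rewrite inE/= in_itv/= => /andP[x0 _].
exact: fg.
Qed.

Lemma primitive_cst c t : 0 <= t -> primitive (fun=> c) t = c * t.
Proof.
move=> t0; rewrite /primitive Rintegral_cst; last exact: measurable_itv_completed.
by rewrite [X in fine X](completed_lebesgue_measure_itvcc t0) /= subr0.
Qed.

Lemma le_norm_integral_itv f M (i : interval R) :
  mu.-integrable [set` i] (EFin \o f) -> (mu [set` i] < +oo)%E ->
  (forall r, r \in i -> `|f r| <= M) ->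
  `|\int[mu]_(s in [set` i]) f s| <= M * fine (mu [set` i]).
Proof.
move=> fi mi fM; have mI := measurable_itv_completed i.
apply: (le_trans (le_normr_Rintegral mI fi)); rewrite -Rintegral_cst//.
apply: le_Rintegral => //.
- exact: integrable_norm fi.
- apply: measurable_bounded_integrable => //.
  by exists `|M|; split; [exact: num_real|move=> x Mx y _ /=; exact: ltW].
Qed.

Lemma primitive0 f : loc_bdd_meas f -> primitive f 0 = 0.
Proof.
move=> bf; have [_ [M HM]] := bf 0 (lexx 0).
apply/eqP; rewrite -normr_le0.
have m0 : mu `[0, 0] = 0%E by rewrite completed_lebesgue_measure_itvcc// subrr.
have := @le_norm_integral_itv f M `[0, 0].
rewrite [X in fine X]m0 [X in (X < _)%E]m0 mulr0; apply => //.
  exact: loc_bdd_meas_integrable.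
by move=> r; rewrite in_itv/= => /andP[r0 r1]; exact: HM.
Qed.

Lemma primitive_lipschitz f M s t : loc_bdd_meas f -> 0 <= s -> s <= t ->
  (forall r, s <= r -> r <= t -> `|f r| <= M) ->
  `|primitive f t - primitive f s| <= M * (t - s).
Proof.
move=> bf s0 st fM; rewrite /primitive.
have t0 := le_trans s0 st.
have itv : `[0, t]%classic = `[0, s]%classic `|` `]s, t]%classic.
  by rewrite -itv_bndbnd_setU// ?bnd_simp.
have fi : mu.-integrable `]s, t] (EFin \o f).
  apply: (@integrableS _ _ _ mu `[0, t]%classic).
  - exact: measurable_itv_completed.
  - exact: measurable_itv_completed.
  - by rewrite itv; exact: subsetUr.
  - exact: loc_bdd_meas_integrable.
have -> : \int[mu]_(r in `[0, t]) f r =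
    \int[mu]_(r in `[0, s]) f r + \int[mu]_(r in `]s, t]) f r.
  rewrite itv; apply: Rintegral_setU.
  - exact: measurable_itv_completed.
  - exact: measurable_itv_completed.
  - by rewrite -itv; exact: loc_bdd_meas_integrable.
  - apply/disj_setPS => y [/=]; rewrite 2!in_itv/= => /andP[_ ys] /andP[].
    by rewrite ltNge ys.
rewrite addrAC subrr add0r.
have mst : mu `]s, t] = (t - s)%:E.
  transitivity (lebesgue_measure (`]s, t]%classic : set R)); first by [].
  rewrite lebesgue_measure_itv /= lte_fin; case: ltP => //.
  by move=> ts; have -> : s = t by [apply/eqP; rewrite eq_le st]; rewrite subrr.
have := @le_norm_integral_itv f M `]s, t].
rewrite [X in fine X]mst [X in (X < _)%E]mst/=; apply => //.
  by rewrite ltry.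
by move=> r; rewrite in_itv/= => /andP[sr rt]; apply: fM => //; exact: ltW.
Qed.
End CompletedIntegral.

(** * Primitives of locally bounded functions *)

Section Primitives.
Context {R : realType}.
Implicit Types (f g F G E : R -> R) (s t T : R).

Lemma half_cont_of_lipschitz F :
  (forall T, 0 <= T -> exists C, forall s t, 0 <= s -> s <= t -> t <= T ->
     `|F t - F s| <= C * (t - s)) -> half_cont F.
Proof.
move=> H; apply/half_contP/subspace_continuousP => t.
rewrite /halfline/= in_itv/= andbT => t0.
apply/cvgrPdist_le => e e0.
have [C HC] := H (t + 1) (addr_ge0 t0 ler01).
pose C' := Num.max 1 C.
have C'0 : 0 < C' by rewrite lt_max ltr01.
have HC' a b : 0 <= a -> a <= b -> b <= t + 1 -> `|F b - F a| <= C' * (b - a).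
  move=> a0 ab bt; apply: (le_trans (HC _ _ a0 ab bt)).
  by rewrite ler_wpM2r ?subr_ge0// le_max lexx orbT.
have d0 : 0 < Num.min 1 (e / C') by rewrite lt_min ltr01 divr_gt0.
rewrite near_withinE; near=> s; rewrite /= in_itv/= andbT => s0.
have : `|t - s| < Num.min 1 (e / C') by near: s; exact: nbhsx_ballx d0.
rewrite lt_min ltr_pdivlMr// mulrC => /andP[st1 st2].
have [ts|st] := leP t s.
  rewrite distrC in st1 st2; rewrite distrC.
  rewrite ger0_norm ?subr_ge0// in st1 st2.
  by rewrite (le_trans _ (ltW st2))// HC'//; lra.
rewrite ger0_norm ?subr_ge0// ?(ltW st)// in st1 st2.
by rewrite (le_trans _ (ltW st2))// HC'//; lra.
Unshelve. all: by end_near. Qed.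

Lemma half_cont_comp (h : R -> R) F : continuous h -> half_cont F ->
  half_cont (fun t => h (F t)).
Proof.
by move=> ch cF x; apply: (cvg_comp (fun x : R => F (Num.max 0 x)) h (cF x)); exact: ch.
Qed.

Lemma half_cont_primitive f : loc_bdd_meas f -> half_cont (primitive f).
Proof.
move=> bf; apply: half_cont_of_lipschitz => T T0; have [_ [M HM]] := bf T T0.
exists M => s t s0 st tT; apply: primitive_lipschitz => // r sr rt; apply: HM.
  exact: le_trans sr.
exact: le_trans tT.
Qed.

(** [F] is absolutely continuous with a locally bounded density [f]; [F] need
    not be differentiable everywhere. *)
Definition is_primitive F f :=
  loc_bdd_meas f /\ forall t, 0 <= t -> F t = F 0 + primitive f t.

Lemma is_primitive_of_quadratic F f : loc_bdd_meas f ->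
  (forall T, 0 <= T -> exists C, forall s t, 0 <= s -> s <= t -> t <= T ->
     `|F t - F s - (primitive f t - primitive f s)| <= C * (t - s) ^+ 2) ->
  is_primitive F f.
Proof.
move=> bf H; split => // t t0.
have := @const_of_quadratic_increments _ (fun t => F t - primitive f t) _ t t0.
rewrite primitive0// subr0 => <-; first by rewrite subrK.
move=> T T0; have [C HC] := H T T0; exists C => a b a0 ab bT.
by rewrite (_ : _ - _ = F b - F a - (primitive f b - primitive f a)) ?HC//; ring.
Qed.

Lemma is_primitive_incr F f s t : is_primitive F f -> 0 <= s -> 0 <= t ->
  F t - F s = primitive f t - primitive f s.
Proof. by move=> [bf H] s0 t0; rewrite (H t)// (H s)//; ring. Qed.

Lemma is_primitive_half_cont F f : is_primitive F f -> half_cont F.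
Proof.
move=> [bf H]; apply: half_cont_of_lipschitz => T T0; have [_ [M HM]] := bf T T0.
exists M => s t s0 st tT; rewrite (@is_primitive_incr F f)//; last exact: le_trans st.
apply: primitive_lipschitz => // r sr rt; apply: HM.
  exact: le_trans sr.
exact: le_trans tT.
Qed.

Lemma is_primitive_lipschitz F f M s t : is_primitive F f -> 0 <= s -> s <= t ->
  (forall r, s <= r -> r <= t -> `|f r| <= M) ->
  `|F t - F s| <= M * (t - s).
Proof.
move=> FP s0 st fM; rewrite (is_primitive_incr FP)//; last exact: le_trans st.
by apply: primitive_lipschitz => //; case: FP.
Qed.

(** Over [s, t] the increment of [F * G] differs from the integral of its expected
    density by the integral of [f r * (G t - G r) + g r * (F s - F r)], and both
    terms are quadratic because [F] and [G] are locally Lipschitz. *)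
Lemma is_primitiveM F G f g : is_primitive F f -> is_primitive G g ->
  is_primitive (fun t => F t * G t) (fun t => f t * G t + F t * g t).
Proof.
move=> FP GP; have [bf _] := FP; have [bg _] := GP.
have bF := half_cont_loc_bdd_meas (is_primitive_half_cont FP).
have bG := half_cont_loc_bdd_meas (is_primitive_half_cont GP).
have bh : loc_bdd_meas (fun t => f t * G t + F t * g t).
  by apply: loc_bdd_measD; apply: loc_bdd_measM.
apply: is_primitive_of_quadratic => // T T0.
have [_ [M1 HM1]] := bf T T0; have [_ [M2 HM2]] := bg T T0.
have M10 : 0 <= M1 by apply: le_trans (normr_ge0 _) (HM1 0 _ _).
have M20 : 0 <= M2 by apply: le_trans (normr_ge0 _) (HM2 0 _ _).
exists (M1 * M2 + M2 * M1) => s t s0 st tT.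
have t0 := le_trans s0 st.
(* [k] is the density of the error term, with [s] and [t] frozen. *)
pose k r := (G t * f r + F s * g r) - (f r * G r + F r * g r).
have b1 c : loc_bdd_meas (fun r => c * f r).
  by apply: loc_bdd_measM => //; exact: loc_bdd_meas_cst.
have b2 c : loc_bdd_meas (fun r => c * g r).
  by apply: loc_bdd_measM => //; exact: loc_bdd_meas_cst.
have kE u : 0 <= u -> primitive k u = G t * primitive f u + F s * primitive g u
    - primitive (fun t => f t * G t + F t * g t) u.
  move=> u0; rewrite (primitiveB u0 (loc_bdd_measD (b1 (G t)) (b2 (F s))) bh).
  by rewrite (primitiveD u0 (b1 _) (b2 _)) (primitiveZ _ u0 bf) (primitiveZ _ u0 bg).
have -> : F t * G t - F s * G s - (primitive (fun t => f t * G t + F t * g t) t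
    - primitive (fun t => f t * G t + F t * g t) s) = primitive k t - primitive k s.
  rewrite !kE//.
  have e1 := is_primitive_incr FP s0 t0; have e2 := is_primitive_incr GP s0 t0.
  have -> : F t * G t - F s * G s = G t * (F t - F s) + F s * (G t - G s) by ring.
  rewrite e1 e2; ring.
rewrite expr2 mulrA; apply: primitive_lipschitz => //.
  exact: (loc_bdd_measB (loc_bdd_measD (b1 _) (b2 _)) bh).
move=> r sr rt; have r0 := le_trans s0 sr; have rT := le_trans rt tT.
have -> : k r = f r * (G t - G r) - g r * (F r - F s) by rewrite /k; ring.
rewrite (le_trans (ler_normB _ _))// !normrM mulrDl lerD//.
  rewrite -mulrA ler_pM ?HM1//.
  apply: le_trans (is_primitive_lipschitz (M:=M2) GP r0 rt _) _.
    by move=> u ru ut; apply: HM2; [exact: le_trans ru|exact: le_trans tT].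
  by rewrite ler_wpM2l//; lra.
rewrite -mulrA ler_pM ?HM2//.
apply: le_trans (is_primitive_lipschitz (M:=M1) FP s0 sr _) _.
  by move=> u ru ut; apply: HM1; [exact: le_trans ru|apply: le_trans rT].
by rewrite ler_wpM2l//; lra.
Qed.

Lemma expR_mean_value (x y : R) : exists c, (x <= c <= y \/ y <= c <= x) /\
  expR y - expR x = expR c * (y - x).
Proof.
have cE a b : {within `[a, b], continuous (@expR R)}.
  by apply: continuous_subspaceT; exact: continuous_expR.
have [xy|yx] := leP x y.
  have [c cxy e] := MVT_segment xy (fun z _ => is_derive_expR z) (cE _ _).
  by exists c; split => //; left; move: cxy; rewrite in_itv.
have [c cxy e] := MVT_segment (ltW yx) (fun z _ => is_derive_expR z) (cE _ _).
exists c; split; first by right; move: cxy; rewrite in_itv.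
by rewrite -opprB e; ring.
Qed.

Lemma expR_lipschitz (B x y : R) : x <= B -> y <= B ->
  `|expR y - expR x| <= expR B * `|y - x|.
Proof.
move=> xB yB; have [c [cxy ->]] := expR_mean_value x y.
rewrite normrM ler_wpM2r// ger0_norm ?expR_ge0// ler_expR.
by case: cxy => /andP[]; lra.
Qed.

Lemma between_le (x y c B : R) : (x <= c <= y \/ y <= c <= x) ->
  x <= B -> y <= B -> c <= B.
Proof. by case=> /andP[? ?] ? ?; lra. Qed.

Lemma between_dist (x y c z K : R) : (x <= c <= y \/ y <= c <= x) ->
  `|x - z| <= K -> `|y - z| <= K -> `|c - z| <= K.
Proof.
rewrite !ler_norml => h /andP[? ?] /andP[? ?].
by apply/andP; case: h => /andP[? ?]; split; lra.
Qed.

(** By the mean value theorem the increment over [s, t] is [exp c] times that of the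
    exponent, with [c] between its end values; replacing [exp c] by the running value
    under the integral costs a quadratic error. *)
Lemma is_primitive_expR f : loc_bdd_meas f ->
  is_primitive (fun t => expR (primitive f t)) (fun t => f t * expR (primitive f t)).
Proof.
move=> bf; have cp := half_cont_primitive bf.
have ce : half_cont (fun t => expR (primitive f t)).
  exact: (half_cont_comp (@continuous_expR R) cp).
have be := half_cont_loc_bdd_meas ce.
have bh := loc_bdd_measM bf be.
apply: is_primitive_of_quadratic => //.
move=> T T0; have [_ [M HM]] := bf T T0; have [B HB] := half_cont_bounded T0 cp.
have M0 : 0 <= M by apply: le_trans (normr_ge0 _) (HM 0 _ _).
exists (M * (expR B * M)) => s t s0 st tT.
have t0 := le_trans s0 st; have sT := le_trans st tT.
have [c [cst e]] := expR_mean_value (primitive f s) (primitive f t).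
(* [k] is the density of the error term, with [s] and [t] frozen. *)
pose k r := expR c * f r - f r * expR (primitive f r).
have bc : loc_bdd_meas (fun r => expR c * f r).
  by apply: loc_bdd_measM => //; exact: loc_bdd_meas_cst.
have kE u : 0 <= u -> primitive k u = expR c * primitive f u
    - primitive (fun t => f t * expR (primitive f t)) u.
  by move=> u0; rewrite (primitiveB u0 bc bh) (primitiveZ _ u0 bf).
have -> : expR (primitive f t) - expR (primitive f s)
    - (primitive (fun t => f t * expR (primitive f t)) t
       - primitive (fun t => f t * expR (primitive f t)) s)
   = primitive k t - primitive k s.
  by rewrite e !kE//; ring.
rewrite expr2 mulrA; apply: primitive_lipschitz => //.
  exact: (loc_bdd_measB bc bh).
move=> r sr rt; have r0 := le_trans s0 sr; have rT := le_trans rt tT.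
have -> : k r = f r * (expR c - expR (primitive f r)) by rewrite /k; ring.
rewrite normrM -mulrA ler_pM ?HM//.
have fb a b : s <= a -> a <= b -> b <= t ->
    `|primitive f b - primitive f a| <= M * (t - s).
  move=> sa ab bt; apply: (@le_trans _ _ (M * (b - a))).
    apply: primitive_lipschitz => //; first exact: le_trans sa.
    move=> u au ub; apply: HM; last exact: le_trans (le_trans ub bt) tT.
    exact: le_trans (le_trans s0 sa) au.
  by rewrite ler_wpM2l//; exact: lerB.
have /ler_normlP[h1 h1'] := HB _ s0 sT; have /ler_normlP[h2 h2'] := HB _ t0 tT.
have /ler_normlP[h3 h3'] := HB _ r0 rT.
apply: (le_trans (expR_lipschitz (B := B) h3' (between_le cst h1' h2'))).
rewrite -mulrA ler_wpM2l ?expR_ge0// (between_dist cst)//.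
  by rewrite distrC; exact: fb.
exact: fb.
Qed.

(** The difference of [F] and the integral of its derivative has slope zero
    everywhere, as [f] is continuous. *)
Lemma is_primitive_C1 F f : half_cont f ->
  (forall t, 0 <= t ->
    (x - t)^-1 * (F x - F t) @[x --> within halfline (t^')] --> f t) ->
  is_primitive F f.
Proof.
move=> cf dF; have bf := half_cont_loc_bdd_meas cf; split => // t t0.
have := @const_of_zero_slope _ (fun t => F t - primitive f t) _ t t0.
rewrite primitive0// subr0 => <-; first by rewrite subrK.
move=> {}t {}t0 e e0; have e20 : 0 < e / 2 by rewrite divr_gt0.
have /cvgrPdist_le/(_ _ e20) H1 := dF _ t0.
have H2 := cf t; rewrite /continuous_at max_r// in H2.
move/cvgrPdist_le: H2 => /(_ _ e20)/nbhs_ballP[d /= d0 Hd].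
rewrite !near_withinE in H1.
have H3 : \forall s \near t, `|t - s| < d by exact: nbhsx_ballx d0.
near=> s => s0.
have [->|nst] := eqVneq s t; first by rewrite !subrr normr0 mulr0.
have st : `|t - s| < d by near: s.
have h1 : `|F s - F t - f t * (s - t)| <= e / 2 * `|s - t|.
  have : s != t -> halfline s -> `|f t - (s - t)^-1 * (F s - F t)| <= e / 2.
    by near: s.
  rewrite /halfline/= in_itv/= andbT => /(_ nst s0) h.
  have -> : F s - F t - f t * (s - t) = - (f t - (s - t)^-1 * (F s - F t)) * (s - t).
    by field; rewrite subr_eq0.
  by rewrite normrM normrN ler_wpM2r.
have bc : loc_bdd_meas (fun=> f t : R) := loc_bdd_meas_cst (f t).
have h2 a b : 0 <= a -> a <= b -> (forall r, a <= r -> r <= b -> `|t - r| < d) ->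
    `|primitive f b - primitive f a - f t * (b - a)| <= e / 2 * (b - a).
  move=> a0 ab ad; have b0 := le_trans a0 ab.
  have -> : primitive f b - primitive f a - f t * (b - a) =
      primitive (fun r => f r - f t) b - primitive (fun r => f r - f t) a.
    by rewrite (primitiveB a0 bf bc) (primitiveB b0 bf bc) !primitive_cst//; ring.
  apply: (primitive_lipschitz (loc_bdd_measB bf bc) a0 ab).
  move=> r ar rb; have := Hd r (ad _ ar rb); rewrite max_r ?(le_trans a0 ar)//.
  by rewrite distrC.
have h3 : `|primitive f s - primitive f t - f t * (s - t)| <= e / 2 * `|s - t|.
  have [ts|] := leP t s.
    rewrite (ger0_norm (x := s - t)) ?subr_ge0//; apply: h2 => // r tr rs.
    by apply: le_lt_trans st; rewrite distrC [leRHS]distrC !ger0_norm ?subr_ge0//; lra.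
  move=> /ltW ts; rewrite (distrC s t) (ger0_norm (x := t - s)) ?subr_ge0//.
  have -> : primitive f s - primitive f t - f t * (s - t) =
    - (primitive f t - primitive f s - f t * (t - s)) by ring.
  rewrite normrN.
  apply: h2 => // r sr rt.
  by apply: le_lt_trans st; rewrite !ger0_norm ?subr_ge0//; lra.
have -> : F s - primitive f s - (F t - primitive f t) =
  (F s - F t - f t * (s - t)) - (primitive f s - primitive f t - f t * (s - t)) by ring.
by apply: le_trans (ler_normB _ _) _; lra.
Unshelve. all: by end_near. Qed.

End Primitives.

(** * Matrix norms and Caratheodory solutions *)

Section MatrixNorm.
Context {R : realType}.

Lemma mx_norm_leP m n (A : 'M[R]_(m, n)) (c : R) : 0 <= c ->
  (`|A| <= c) <-> (forall i j, `|A i j| <= c).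
Proof.
move=> c0; rewrite /Num.norm/= mx_normrE; split.
  by move=> /bigmax_leP[_ H] i j; exact: (H (i, j)).
by move=> H; apply: bigmax_le => // -[i j] _; exact: H.
Qed.

Lemma mx_entry_le m n (A : 'M[R]_(m, n)) i j : `|A i j| <= `|A|.
Proof. exact: (mx_norm_leP A (normr_ge0 A)).1. Qed.

Lemma mx_norm_mul m n p (A : 'M[R]_(m, n)) (B : 'M[R]_(n, p)) :
  `|A *m B| <= n%:R * `|A| * `|B|.
Proof.
apply/mx_norm_leP => [|i j]; first by rewrite !mulr_ge0.
rewrite mxE (le_trans (ler_norm_sum _ _ _))//.
apply: (@le_trans _ _ (\sum_(k < n) `|A| * `|B|)).
  by apply: ler_sum => k _; rewrite normrM ler_pM ?mx_entry_le.
by rewrite sumr_const card_ord -[leLHS]mulr_natl mulrA.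
Qed.

Lemma mx_norm_mul_le m n p (A : 'M[R]_(m, n)) (B : 'M[R]_(n, p)) a b :
  `|A| <= a -> `|B| <= b -> `|A *m B| <= n%:R * a * b.
Proof.
move=> Aa Bb; apply: le_trans (mx_norm_mul _ _) _.
by rewrite ler_pM ?mulr_ge0// ler_wpM2l.
Qed.

Lemma mx_norm1_le n : `|1%:M : 'M[R]_n| <= 1.
Proof.
apply/mx_norm_leP => // i j; rewrite mxE.
by case: (i == j); rewrite ?normr1 ?normr0.
Qed.

Lemma cvg_mx (T : Type) (F : set_system T) (FF : Filter F) m n
    (f : T -> 'M[R]_(m, n)) (l : 'M[R]_(m, n)) :
  (forall i j, f x i j @[x --> F] --> l i j) -> f x @[x --> F] --> l.
Proof.
move=> H; apply/cvgrPdist_le => e e0.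
have H2 : \forall x \near F, forall i, forall j, `|l i j - f x i j| <= e.
  apply: filter_forall => i; apply: filter_forall => j.
  by have /cvgrPdist_le/(_ _ e0) := H i j.
apply: filterS H2 => x H2; apply/mx_norm_leP => [|i j]; first exact: ltW.
by rewrite !mxE.
Qed.

End MatrixNorm.

Section Solutions.
Context {R : realType}.

(** Matrix-valued solutions cover vector solutions, the fundamental matrix and the
    transition matrices at once. *)
Definition is_solution d m (A : R -> 'M[R]_d) (W : R -> 'M[R]_(d, m)) :=
  forall i j, is_primitive (fun t => W t i j) (fun t => (A t *m W t) i j).

Lemma is_solution_mulr d m p (A : R -> 'M[R]_d) (W : R -> 'M[R]_(d, m))
    (C : 'M[R]_(m, p)) :
  is_solution A W -> is_solution A (fun t => W t *m C).
Proof.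
move=> HW i j.
have b k : loc_bdd_meas (fun t => C k j * (A t *m W t) i k).
  by apply: loc_bdd_measM; [exact: loc_bdd_meas_cst|case: (HW i k)].
have E (t : R) : (A t *m (W t *m C)) i j = \sum_k C k j * (A t *m W t) i k.
  by rewrite mulmxA mxE; apply: eq_bigr => k _; rewrite mulrC.
split.
  by apply: eq_loc_bdd_meas (loc_bdd_meas_sum _ b) => t _; rewrite E.
move=> t t0; rewrite !mxE.
rewrite (eq_primitive (g := fun t => \sum_k C k j * (A t *m W t) i k))//.
have -> : primitive (fun t => \sum_k C k j * (A t *m W t) i k) t =
    \sum_k C k j * primitive (fun t => (A t *m W t) i k) t.
  elim: (index_enum _) => [|k r IH].
    transitivity (0 * t); last by rewrite mul0r big_nil.
    rewrite -(primitive_cst 0 t0).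
    by apply: eq_primitive => s _; rewrite big_nil.
  rewrite big_cons -IH -(primitiveZ _ t0); last by case: (HW i k).
  rewrite -(primitiveD t0 (b k) (loc_bdd_meas_sum r b)).
  by apply: eq_primitive => s _; rewrite big_cons.
rewrite -big_split/=; apply: eq_bigr => k _.
by have [_ ->//] := HW i k; rewrite mulrDl; congr (_ + _); rewrite mulrC.
Qed.

Lemma is_solutionB d m (A : R -> 'M[R]_d) (W V : R -> 'M[R]_(d, m)) :
  is_solution A W -> is_solution A V -> is_solution A (fun t => W t - V t).
Proof.
move=> HW HV i j; have [bW eW] := HW i j; have [bV eV] := HV i j.
have E (t : R) : (A t *m (W t - V t)) i j = (A t *m W t) i j - (A t *m V t) i j.
  by rewrite mulmxBr !mxE.
split.
  by apply: eq_loc_bdd_meas (loc_bdd_measB bW bV) => t _; rewrite E.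
move=> t t0.
rewrite (eq_primitive (g := fun t => (A t *m W t) i j - (A t *m V t) i j))//.
by rewrite (primitiveB t0 bW bV) !mxE -!/(_ *m _) eW// eV//; ring.
Qed.

Lemma is_solution_continuous d m (A : R -> 'M[R]_d) (W : R -> 'M[R]_(d, m)) :
  is_solution A W -> continuous (fun t : R => W (Num.max 0 t)).
Proof.
by move=> HW x; apply: cvg_mx => i j; exact: (is_primitive_half_cont (HW i j)).
Qed.

Section Growth.
Context (d m : nat) (A : R -> 'M[R]_d) (W : R -> 'M[R]_(d, m)) (M : R).
Hypotheses (M0 : 0 <= M) (AM : forall t, 0 <= t -> `|A t| <= M).
Hypothesis HW : is_solution A W.

Let L : R := 2 * (d%:R * M) + 1.

(** On an interval so short that [d * M] times its length is at most one half, the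
    solution oscillates by at most half of its maximal norm, so any two of its values
    are comparable up to the factor 2.  The argument is symmetric in time, hence
    bounds growth and decay together. *)
Lemma solution_doubling s t : 0 <= s -> 0 <= t -> `|t - s| * L <= 1 ->
  `|W t| <= 2 * `|W s|.
Proof.
have L0 : 0 < L by rewrite ltr_wpDl// !mulr_ge0.
move=> s0 t0 tsL.
pose a := Num.min s t; pose b := Num.max s t.
have ab : a <= b by rewrite /a /b le_max ge_min lexx.
have a0 : 0 <= a by rewrite le_min s0.
have baL : (b - a) * L <= 1.
  move: tsL; rewrite /a /b; case: (leP s t) => st.
    by rewrite ger0_norm ?subr_ge0.
  by rewrite distrC ger0_norm ?subr_ge0// ltW.
have [|c cab Hc] := @EVT_max R (fun r => `|W (Num.max 0 r)|) a b ab.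
  by apply: continuous_subspaceT => r; apply: cvg_norm; exact: is_solution_continuous.
have Hc' r : a <= r -> r <= b -> `|W r| <= `|W c|.
  move=> ar rb; have := Hc r; rewrite in_itv/= ar rb !max_r ?(le_trans a0 ar)//.
    by apply.
  by move: cab; rewrite in_itv/= => /andP[? _]; exact: le_trans a0 _.
move: cab; rewrite in_itv/= => /andP[ac cb].
have osc x y : a <= x -> x <= y -> y <= b -> `|W y - W x| <= `|W c| / 2.
  move=> ax xy yb; apply/mx_norm_leP => [|i j]; first by rewrite divr_ge0.
  rewrite !mxE.
  apply: (@le_trans _ _ (d%:R * M * `|W c| * (y - x))).
    apply: (is_primitive_lipschitz (HW i j)) => //; first exact: le_trans ax.
    move=> r xr ry; have ar := le_trans ax xr; have rb := le_trans ry yb.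
    apply: le_trans (mx_entry_le _ _ _) _.
    by apply: mx_norm_mul_le; [apply: AM; exact: le_trans ar|exact: Hc'].
  rewrite mulrAC [leLHS]mulrC ler_wpM2l//.
  have yx : y - x <= b - a by exact: lerB.
  have yx0 : 0 <= y - x by rewrite subr_ge0.
  have : d%:R * M * (y - x) <= d%:R * M * (b - a) by rewrite ler_wpM2l ?mulr_ge0.
  move: baL yx yx0; rewrite /L; move: (d%:R * M) (b - a) (y - x) => u v w.
  by nra.
have oscs x y : a <= x -> x <= b -> a <= y -> y <= b -> `|W y - W x| <= `|W c| / 2.
  move=> ax xb ay yb; have [xy|yx] := leP x y; first exact: osc.
  by rewrite distrC osc// ltW.
have sa : a <= s by rewrite ge_min lexx.
have sb : s <= b by rewrite le_max lexx.
have ta : a <= t by rewrite ge_min lexx orbT.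
have tb : t <= b by rewrite le_max lexx orbT.
have h1 := oscs _ _ sa sb ac cb.
have h2 : `|W c| <= `|W c - W s| + `|W s|.
  by rewrite -{1}(subrK (W s) (W c)) ler_normD.
have := Hc' _ ta tb; move: h1 h2.
by move: (`|W c - W s|) (`|W c|) (`|W s|) (`|W t|) => u v w z; lra.
Qed.

(** The chain goes through the point at the fraction [n / n.+1] of the way from [s]
    to [t]. *)
Lemma solution_doubling_iter n s t : 0 <= s -> 0 <= t -> `|t - s| * L <= n%:R ->
  `|W t| <= 2 ^+ n * `|W s|.
Proof.
have L0 : 0 < L by rewrite ltr_wpDl// !mulr_ge0.
elim: n s t => [|n IH] s t s0 t0 h.
  have : `|t - s| <= 0 by rewrite -(pmulr_lle0 _ L0).
  by rewrite normr_le0 subr_eq0 => /eqP ->; rewrite expr0 mul1r.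
pose u := s + n%:R / n.+1%:R * (t - s).
have n1 : 0 < n.+1%:R :> R by rewrite ltr0n.
have uE : u = n.+1%:R^-1 * s + n%:R / n.+1%:R * t.
  by rewrite /u -natr1; field; rewrite natr1 gt_eqF.
have u0 : 0 <= u by rewrite uE addr_ge0// !mulr_ge0// invr_ge0 ltW.
have us : `|u - s| * L <= n%:R.
  rewrite /u addrAC subrr add0r normrM ger0_norm ?divr_ge0//.
  by rewrite -mulrA (le_trans (ler_wpM2l _ h)) ?divr_ge0// divfK ?gt_eqF.
have tu : `|t - u| * L <= 1.
  have -> : t - u = n.+1%:R^-1 * (t - s).
    by rewrite /u -natr1; field; rewrite natr1 gt_eqF.
  rewrite normrM ger0_norm ?invr_ge0// -mulrA mulrC ler_pdivrMr// mul1r.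
  exact: h.
apply: le_trans (solution_doubling u0 t0 tu) _.
by rewrite exprS -mulrA ler_wpM2l// IH.
Qed.

Lemma solution_growth s t : 0 <= s -> 0 <= t ->
  `|W t| <= expR (1 + L * `|t - s|) * `|W s|.
Proof.
move=> s0 t0.
have L0 : 0 <= L by rewrite addr_ge0// !mulr_ge0.
have [] := andP (truncn_itv (mulr_ge0 (normr_ge0 (t - s)) L0)).
set n := Num.truncn _ => h1 h2.
apply: le_trans (solution_doubling_iter s0 t0 (ltW h2)) _.
rewrite ler_wpM2r// (@le_trans _ _ (expR 1 ^+ n.+1))//.
  by rewrite lerXn2r ?nnegrE ?expR_ge0// (le_trans _ (expR_ge1Dx _)).
by rewrite -expRM_natl mulr1 ler_expR -natr1 addrC lerD2l mulrC.
Qed.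

End Growth.

End Solutions.

(** * The fundamental matrix of a diagonalizable system *)

Section DiagonalForm.
Context {R : realType}.

Lemma bounded_mxP m n (A : R -> 'M[R]_(m, n)) : bounded_mx A ->
  exists M, 0 <= M /\ forall t, 0 <= t -> `|A t| <= M.
Proof.
move=> [M0 [_ HM]]; exists (Num.max 0 M0 + 1).
have h : Num.max 0 M0 < Num.max 0 M0 + 1 by rewrite ltrDl.
split; first by rewrite addr_ge0// le_max lexx.
move=> t t0; apply: (HM (Num.max 0 M0 + 1)).
  by apply: le_lt_trans h; rewrite le_max lexx orbT.
by rewrite /halfline /= in_itv/= t0.
Qed.

Lemma half_cont_comp_within (V : topologicalType) (f : R -> V) (g : V -> R) :
  {within halfline, continuous f} -> continuous g -> half_cont (fun t => g (f t)).
Proof.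
move=> cf cg; apply/half_contP => x; apply: (cvg_comp f g (cf x)); exact: cg.
Qed.

Lemma eq_is_primitive (F G f g : R -> R) : (forall t, 0 <= t -> F t = G t) ->
  (forall t, 0 <= t -> f t = g t) -> is_primitive F f -> is_primitive G g.
Proof.
move=> FG fg [bf e]; split; first exact: eq_loc_bdd_meas bf.
by move=> t t0; rewrite -!FG// e// (eq_primitive _ fg).
Qed.

Lemma loc_bdd_meas_of_integrable m n (A : R -> 'M[R]_(m, n)) i j :
  loc_integrable_mx A ->
  (forall T, 0 <= T -> exists M, forall t, 0 <= t -> t <= T -> `|A t i j| <= M) ->
  loc_bdd_meas (fun t => A t i j).
Proof.
move=> iA bA T T0; split; last exact: bA.
have /measurable_int := iA T i j T0.
by move/measurable_EFinP.
Qed.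

Lemma fundamental_matrix_solution d (A X : R -> 'M[R]_d) :
  loc_integrable_mx A -> bounded_mx A -> is_fundamental_matrix A X ->
  is_solution A X /\ X 0 = 1%:M.
Proof.
move=> iA /bounded_mxP[M [M0 AM]] [cX XE].
have bA i j : loc_bdd_meas (fun t => A t i j).
  apply: loc_bdd_meas_of_integrable => // T T0; exists M => t t0 _.
  by apply: le_trans (mx_entry_le _ _ _) _; exact: AM.
have cXij i j : half_cont (fun t => X t i j).
  exact: (half_cont_comp_within cX (@coord_continuous _ _ _ i j)).
have bAX i j : loc_bdd_meas (fun t => (A t *m X t) i j).
  have b k : loc_bdd_meas (fun t => A t i k * X t k j).
    by apply: loc_bdd_measM => //; exact: half_cont_loc_bdd_meas.
  by apply: eq_loc_bdd_meas (loc_bdd_meas_sum _ b) => t _; rewrite mxE.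
have X0 : X 0 = 1%:M.
  apply/matrixP => i j; rewrite XE//.
  by have := primitive0 (bAX i j); rewrite /primitive => ->; rewrite addr0.
by split=> // i j; split=> // t t0; rewrite XE// X0.
Qed.

(** The difference is a solution that vanishes at 0, and solutions grow by at most a
    finite factor. *)
Lemma solution_unique d m (A : R -> 'M[R]_d) (V W : R -> 'M[R]_(d, m)) :
  bounded_mx A -> is_solution A V -> is_solution A W -> V 0 = W 0 ->
  forall t, 0 <= t -> V t = W t.
Proof.
move=> /bounded_mxP[M [M0 AM]] HV HW VW t t0.
have := solution_growth M0 AM (is_solutionB HV HW) (lexx 0) t0.
by rewrite VW subrr normr0 mulr0 normr_le0 subr_eq0 => /eqP.
Qed.

(** The equation for [dS] reads [diag a = S^-1 (A S - dS)], so the diagonal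
    coefficients, assumed only locally integrable, are in fact locally bounded: the
    rules of calculus apply to the columns [exp (b_j) S e_j]. *)
Lemma diagonal_form d (A X : R -> 'M[R]_d) :
  loc_integrable_mx A -> bounded_mx A -> diagonalizable_system A ->
  is_fundamental_matrix A X ->
  exists (S : R -> 'M[R]_d) (b : 'I_d -> R -> R) (C : R),
  [/\ (forall i, half_cont (b i)),
      (forall t, 0 <= t -> S t \in unitmx),
      (forall t, 0 <= t -> `|S t| <= C),
      (forall t, 0 <= t -> `|invmx (S t)| <= C) &
      forall t, 0 <= t ->
        X t = S t *m diag_mx (\row_i expR (b i t)) *m invmx (S 0)].
Proof.
move=> iA bA [a [ia [S [dS [[SD cdS] Su bS bSi dSE]]]]] fX.
have [HX X0] := fundamental_matrix_solution iA bA fX.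
have [M [M0 AM]] := bounded_mxP bA.
have [C1 [C10 HC1]] := bounded_mxP bS; have [C2 [C20 HC2]] := bounded_mxP bSi.
have cdSn : half_cont (fun t => `|dS t|).
  exact: (half_cont_comp_within cdS (@norm_continuous _ _)).
have ba i : loc_bdd_meas (fun t => a t 0 i).
  apply: loc_bdd_meas_of_integrable => // T T0.
  have [D HD] := half_cont_bounded T0 cdSn.
  exists (d%:R * C2 * (d%:R * M * C1 + D)) => t t0 tT.
  have -> : a t 0 i = (invmx (S t) *m (A t *m S t - dS t)) i i.
    rewrite dSE// opprB addrCA subrr addr0 mulKmx ?Su//.
    by rewrite mxE eqxx mulr1n.
  apply: le_trans (mx_entry_le _ _ _) _; apply: mx_norm_mul_le; first exact: HC2.
  apply: le_trans (ler_normB _ _) _; apply: lerD.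
    by apply: mx_norm_mul_le; [exact: AM|exact: HC1].
  by have := HD _ t0 tT; rewrite normr_id.
pose b i := primitive (fun t => a t 0 i).
have b0 i : b i 0 = 0 by exact: primitive0.
exists S, b, (Num.max C1 C2); split => //.
- by move=> i; exact: half_cont_primitive.
- by move=> t t0; rewrite le_max HC1.
- by move=> t t0; rewrite le_max HC2// orbT.
pose Z t := S t *m diag_mx (\row_i expR (b i t)).
have HS i j : is_primitive (fun t => S t i j) (fun t => dS t i j).
  apply: is_primitive_C1.
    exact: (half_cont_comp_within cdS (@coord_continuous _ _ _ i j)).
  move=> t t0; have h := cvg_comp _ _ (SD t t0) (@coord_continuous _ _ _ i j (dS t)).
  have -> : (fun x => (x - t)^-1 * (S x i j - S t i j)) =
      (fun M : 'M[R]_d => M i j) \o (fun x => (x - t)^-1 *: (S x - S t)).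
    by apply/funext => x /=; rewrite !mxE.
  exact: h.
have HZ : is_solution A Z.
  move=> i j; have := is_primitiveM (HS i j) (is_primitive_expR (ba j)).
  apply: eq_is_primitive => t t0; rewrite /Z.
    by rewrite mul_mx_diag !mxE.
  have -> : A t *m (S t *m diag_mx (\row_i expR (b i t))) =
      (dS t + S t *m diag_mx (a t)) *m diag_mx (\row_i expR (b i t)).
    by rewrite mulmxA dSE// subrK.
  by rewrite !mul_mx_diag !mxE -/(b j); ring.
move=> t t0; apply: (solution_unique bA HX (is_solution_mulr _ HZ)) => //.
rewrite X0 /Z.
have -> : diag_mx (\row_i expR (b i 0)) = 1%:M :> 'M[R]_d.
  apply/matrixP => i j; rewrite !mxE b0 expR0; case: eqVneq => //.
by rewrite mulmx1 mulmxV ?Su.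
Qed.

(** [X t *m invmx (X s)] is, as a function of [t], the solution with
    value 1 at [s], so its norm at [t] compares with that of the identity. *)
Lemma fundamental_matrix_growth d (A X : R -> 'M[R]_d) :
  bounded_mx A -> is_solution A X ->
  (forall t, 0 <= t -> X t \in unitmx) ->
  exists K L, [/\ 1 <= K, 0 <= L & forall s t, 0 <= s -> 0 <= t ->
    `|X t *m invmx (X s)| <= K * expR (L * `|t - s|)].
Proof.
move=> /bounded_mxP[M [M0 AM]] HX Xu.
exists (expR 1), (2 * (d%:R * M) + 1); split.
- by apply: le_trans (expR_ge1Dx _); rewrite lerDl.
- by rewrite addr_ge0// !mulr_ge0.
move=> s t s0 t0; rewrite -expRD.
apply: le_trans (solution_growth M0 AM (is_solution_mulr (invmx (X s)) HX) s0 t0) _.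
by rewrite mulmxV ?Xu// ler_piMr ?expR_ge0// mx_norm1_le.
Qed.

End DiagonalForm.

(** * The Bohl spectrum lies in the Sacker--Sell spectrum *)

Section Limits.
Context {R : realType}.

Lemma limit_le (x u : nat -> R) (l : \bar R) (c k : R) :
  x n @[n --> \oo] --> +oo -> (u n)%:E @[n --> \oo] --> l ->
  (forall n, 0 < x n -> u n <= c + k / x n) ->
  forall e, 0 < e -> (l <= (c + e)%:E)%E.
Proof.
move=> /cvgryPge xoo ul H e e0; apply: cvge_le ul.
have := xoo (`|k| / e + 1); apply: filterS => n xn.
have x0 : 0 < x n by apply: lt_le_trans xn; rewrite ltr_wpDl// divr_ge0// ltW.
rewrite lee_fin (le_trans (H n x0))// lerD2l ler_pdivrMr// mulrC.
rewrite (le_trans (ler_norm k))// -ler_pdivrMr// (le_trans _ xn)//.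
by rewrite lerDl.
Qed.

Lemma limit_ge (x u : nat -> R) (l : \bar R) (c k : R) :
  x n @[n --> \oo] --> +oo -> (u n)%:E @[n --> \oo] --> l ->
  (forall n, 0 < x n -> c - k / x n <= u n) ->
  forall e, 0 < e -> ((c - e)%:E <= l)%E.
Proof.
move=> /cvgryPge xoo ul H e e0; apply: cvge_ge ul.
have := xoo (`|k| / e + 1); apply: filterS => n xn.
have x0 : 0 < x n by apply: lt_le_trans xn; rewrite ltr_wpDl// divr_ge0// ltW.
rewrite lee_fin (le_trans _ (H n x0))// lerD2l lerN2 ler_pdivrMr// mulrC.
rewrite (le_trans (ler_norm k))// -ler_pdivrMr// (le_trans _ xn)//.
by rewrite lerDl.
Qed.

Lemma ln_ratio_le (C c h p q : R) : 0 < C -> 0 < p -> 0 < q -> 0 < h ->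
  p <= C * expR (c * h) * q -> h^-1 * ln (p / q) <= c + ln C / h.
Proof.
move=> C0 p0 q0 h0 H.
have : ln (p / q) <= ln (C * expR (c * h)).
  by rewrite ler_ln ?posrE ?divr_gt0 ?mulr_gt0 ?expR_gt0// ler_pdivrMr.
rewrite [leRHS]lnM ?posrE ?expR_gt0// expRK => h1.
rewrite mulrC ler_pdivrMr// mulrDl divfK ?gt_eqF// addrC.
exact: h1.
Qed.

Lemma ln_ratio_ge (C c h p q : R) : 0 < C -> 0 < p -> 0 < q -> 0 < h ->
  q <= C * expR (- (c * h)) * p -> c - ln C / h <= h^-1 * ln (p / q).
Proof.
move=> C0 p0 q0 h0 H.
have := @ln_ratio_le C (- c) h q p C0 q0 p0 h0; rewrite mulNr => /(_ H).
rewrite -(invf_div p q) lnV ?posrE ?divr_gt0// mulrN.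
by move: (h^-1 * _) (_ / h) => a b; lra.
Qed.

End Limits.

Section BohlInSackerSell.
Context {R : realType} (d : nat) (X : R -> 'M[R]_d).
Hypothesis Xu : forall t, 0 <= t -> X t \in unitmx.

Lemma unitmx_mul_neq0 (A : 'M[R]_d) (xi : 'cV[R]_d) :
  A \in unitmx -> xi != 0 -> A *m xi != 0.
Proof.
by move=> Au; apply: contra_neq => h; rewrite -(mulKmx Au xi) h mulmx0.
Qed.

Lemma dichotomy_stable gamma P (xi : 'cV[R]_d) :
  exp_dichotomy_with_projector X gamma P ->
  exists C alpha, [/\ 0 < C, 0 < alpha &
   (P *m xi = xi -> forall s t, 0 <= s -> s <= t ->
    `|X t *m xi| <= C * expR ((gamma - alpha) * (t - s)) * `|X s *m xi|)].
Proof.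
move=> [PP [K [alpha [K1 a0 H1 H2]]]]; exists (d%:R * K + 1), alpha.
have K0 : 0 <= K by apply: le_trans K1.
split => // [|Pxi s t s0 st]; first by rewrite ltr_wpDl// mulr_ge0.
have -> : X t *m xi = (X t *m P *m invmx (X s)) *m (X s *m xi).
  by rewrite !mulmxA mulmxKV ?Xu// -mulmxA Pxi.
apply: le_trans (mx_norm_mul_le (H1 _ _ s0 st) (lexx _)) _.
by rewrite mulrA ler_wpM2r// ler_wpM2r ?expR_ge0// lerDl.
Qed.

(** Write [xi = P xi + eta].  The dichotomy makes the stable part at most a constant
    times the unstable part [X s *m eta] for all [s >= 0], and it also bounds the
    unstable part at [s] by the whole solution at any later [t]. *)
Lemma dichotomy_unstable gamma P (xi : 'cV[R]_d) :
  exp_dichotomy_with_projector X gamma P ->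
  exists C alpha, [/\ 0 < C, 0 < alpha &
   (P *m xi != xi -> forall s t, 0 <= s -> s <= t ->
    `|X s *m xi| <= C * expR (- ((gamma + alpha) * (t - s))) * `|X t *m xi|)].
Proof.
move=> [PP [K [alpha [K1 a0 H1 H2]]]].
have K0 : 0 <= K by apply: le_trans K1.
pose K' := d%:R * K; have K'0 : 0 <= K' by rewrite mulr_ge0.
pose eta := (1%:M - P) *m xi.
have Qeta : (1%:M - P) *m eta = eta.
  rewrite /eta mulmxA; congr (_ *m _).
  by rewrite mulmxBr mulmx1 mulmxBl mul1mx PP subrr subr0.
pose rho := K' * `|X 0 *m xi| * (K' / `|X 0 *m eta|).
have rho0 : 0 <= rho by rewrite !mulr_ge0// invr_ge0.
exists ((1 + rho) * K' + 1), alpha; split => //.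
  by rewrite ltr_wpDl// mulr_ge0// addr_ge0.
move=> Pxi s t s0 st; have t0 := le_trans s0 st.
have eta0 : eta != 0.
  apply: contra_neq Pxi; rewrite /eta mulmxBl mul1mx => /eqP.
  by rewrite subr_eq0 => /eqP.
have U (zeta : 'cV[R]_d) u v : 0 <= u -> u <= v ->
    `|X u *m ((1%:M - P) *m zeta)| <=
    K' * expR ((gamma + alpha) * (u - v)) * `|X v *m zeta|.
  move=> u0 uv; have v0 := le_trans u0 uv.
  have -> : X u *m ((1%:M - P) *m zeta) =
      (X u *m (1%:M - P) *m invmx (X v)) *m (X v *m zeta).
    by rewrite !mulmxA mulmxKV ?Xu// -!mulmxA.
  apply: le_trans (mx_norm_mul_le (H2 _ _ u0 uv) (lexx _)) _.
  by rewrite /K' mulrA.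
have hst := U xi _ _ s0 st; rewrite -/eta in hst.
have h0s := U eta _ _ (lexx 0) s0; rewrite Qeta sub0r mulrN in h0s.
have hP : `|X s *m (P *m xi)| <= K' * expR ((gamma - alpha) * s) * `|X 0 *m xi|.
  have -> : X s *m (P *m xi) = (X s *m P *m invmx (X 0)) *m (X 0 *m xi).
    by rewrite !mulmxA mulmxKV ?Xu.
  have := H1 _ _ (lexx 0) s0; rewrite subr0 => h.
  apply: le_trans (mx_norm_mul_le h (lexx _)) _.
  by rewrite /K' mulrA.
have X0eta : 0 < `|X 0 *m eta| by rewrite normr_gt0 unitmx_mul_neq0 ?Xu.
have es : expR ((gamma - alpha) * s) <= K' / `|X 0 *m eta| * `|X s *m eta|.
  apply: (@le_trans _ _ (expR ((gamma + alpha) * s))).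
    by rewrite ler_expR ler_wpM2r// lerD2l; lra.
  rewrite mulrAC ler_pdivlMr//.
  rewrite -(@ler_pM2l _ (expR (- ((gamma + alpha) * s)))) ?expR_gt0//.
  rewrite mulrA -expRD addNr expR0 mul1r mulrA (mulrC (expR _)).
  exact: h0s.
have hxi : `|X s *m xi| <= (1 + rho) * `|X s *m eta|.
  have -> : X s *m xi = X s *m eta + X s *m (P *m xi).
    by rewrite -mulmxDr /eta mulmxBl mul1mx subrK.
  apply: le_trans (ler_normD _ _) _; rewrite mulrDl mul1r lerD2l.
  apply: le_trans hP _; rewrite mulrAC /rho -[leRHS]mulrA.
  by rewrite ler_wpM2l ?mulr_ge0.
apply: le_trans hxi _.
have -> : - ((gamma + alpha) * (t - s)) = (gamma + alpha) * (s - t) by ring.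
apply: le_trans (ler_wpM2l (addr_ge0 ler01 rho0) hst) _.
by rewrite !mulrA ler_wpM2r// ler_wpM2r ?expR_ge0// lerDl.
Qed.


(** A dichotomy at the rate [l] would leave a gap between [l] and every Bohl exponent
    of the solution from [xi]; for an infinite rate, the projector is 1 or 0 and one
    of the two bounds by a finite rate already excludes [l]. *)
Lemma Bohl_sub_SackerSell : Bohl_spectrum X `<=` SackerSell_spectrum X.
Proof.
move=> l [xi /= xi0 [t [s [t0 s0 ts tsl]]]].
have N0 r : 0 <= r -> 0 < `|X r *m xi|.
  by move=> r0; rewrite normr_gt0 unitmx_mul_neq0 ?Xu.
have up gamma P : exp_dichotomy_with_projector X gamma P -> P *m xi = xi ->
    exists c, c < gamma /\ (l <= c%:E)%E.
  move=> D Pxi; have [C [alpha [C0 a0 H]]] := dichotomy_stable xi D.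
  exists (gamma - alpha + alpha / 2); split; first by lra.
  apply: (limit_le (k := ln C) ts tsl); last by rewrite divr_gt0.
  move=> n h0; apply: ln_ratio_le; rewrite ?N0//.
  by apply: H => //; rewrite -subr_ge0 ltW.
have dn gamma P : exp_dichotomy_with_projector X gamma P -> P *m xi != xi ->
    exists c, gamma < c /\ (c%:E <= l)%E.
  move=> D Pxi; have [C [alpha [C0 a0 H]]] := dichotomy_unstable xi D.
  exists (gamma + alpha - alpha / 2); split; first by lra.
  apply: (limit_ge (k := ln C) ts tsl); last by rewrite divr_gt0.
  move=> n h0; apply: ln_ratio_ge; rewrite ?N0//.
  by apply: H => //; rewrite -subr_ge0 ltW.
rewrite /SackerSell_spectrum/=; case: l up dn {tsl} => [gamma||] up dn /=.
- move=> [P D]; have [Pxi|Pxi] := eqVneq (P *m xi) xi.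
    by have [c [c1]] := up _ _ D Pxi; rewrite lee_fin leNgt c1.
  by have [c [c1]] := dn _ _ D Pxi; rewrite lee_fin leNgt c1.
- by move=> [gamma D]; have [|c [_]] := up _ _ D; rewrite ?mul1mx.
- by move=> [gamma D]; have [|c [_]] := dn _ _ D; rewrite ?mul0mx 1?eq_sym.
Qed.

End BohlInSackerSell.

(** * Averages of a scalar exponent over long intervals *)

Section ScalarAlternative.
Context {R : realType}.
Variables (b : R -> R) (gamma : R).
Hypothesis cb : half_cont b.

Let G (s t : R) := b t - b s - gamma * (t - s).

(** If there are long intervals whose average exceeds [gamma] and others whose average
    is below, moving linearly from one to the other keeps the interval long and meets
    an average equal to [gamma]. *)
Lemma scalar_alternative (T e : R) : 0 < T -> 0 < e ->
  [\/ exists s t, [/\ 0 <= s, T <= t - s & `|G s t| <= e * (t - s)],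
      forall s t, 0 <= s -> T <= t - s -> G s t <= - (e * (t - s)) |
      forall s t, 0 <= s -> T <= t - s -> e * (t - s) <= G s t].
Proof.
move=> T0 e0.
have [h|h1] := pselect (exists s t, [/\ 0 <= s, T <= t - s & `|G s t| <= e * (t - s)]).
  exact: Or31.
have [h|h2] := pselect (forall s t, 0 <= s -> T <= t - s -> G s t <= - (e * (t - s))).
  exact: Or32.
apply: Or33 => s2 t2 s20 ts2; rewrite leNgt; apply/negP => lt2.
apply: h2 => s1 t1 s10 ts1; rewrite leNgt; apply/negP => lt1.
(* The segment from (s1, t1) to (s2, t2); it stays in the convex region of long
   intervals. *)
pose sg u := s1 + u * (s2 - s1); pose tau u := t1 + u * (t2 - t1).
have far u : 0 <= u <= 1 -> 0 <= sg u /\ T <= tau u - sg u.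
  move=> /andP[u0 u1]; rewrite /sg /tau; split.
    have -> : s1 + u * (s2 - s1) = (1 - u) * s1 + u * s2 by ring.
    by rewrite addr_ge0// mulr_ge0// subr_ge0.
  have -> : t1 + u * (t2 - t1) - (s1 + u * (s2 - s1)) =
    T + ((1 - u) * (t1 - s1 - T) + u * (t2 - s2 - T)) by ring.
  by rewrite lerDl addr_ge0// mulr_ge0// subr_ge0.
pose phi u := b (Num.max 0 (tau u)) - b (Num.max 0 (sg u)) - gamma * (tau u - sg u).
have phiE u : 0 <= u <= 1 -> phi u = G (sg u) (tau u).
  move=> /far[s0 ts]; rewrite /phi /G !max_r//.
  by rewrite (le_trans s0)// -subr_ge0 (le_trans (ltW T0)).
have affc (p q : R) : continuous (fun u : R => p + u * q).
  move=> u; apply: cvgD; first exact: cvg_cst.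
  by apply: cvgM; [exact: cvg_id|exact: cvg_cst].
have cphi : continuous phi.
  move=> u; apply: cvgB.
    apply: cvgB.
      by apply: (cvg_comp tau (fun x : R => b (Num.max 0 x)) (affc _ _ u)); exact: cb.
    by apply: (cvg_comp sg (fun x : R => b (Num.max 0 x)) (affc _ _ u)); exact: cb.
  by apply: cvgM; [exact: cvg_cst|apply: cvgB; exact: affc].
have sg0 : sg 0 = s1 by rewrite /sg mul0r addr0.
have tau0 : tau 0 = t1 by rewrite /tau mul0r addr0.
have sg1 : sg 1 = s2 by rewrite /sg mul1r addrC subrK.
have tau1 : tau 1 = t2 by rewrite /tau mul1r addrC subrK.
have phi0 : 0 <= phi 0.
  rewrite phiE ?lexx ?ler01// sg0 tau0 leNgt; apply/negP => g0.
  apply: h1; exists s1, t1; split => //.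
  by rewrite ltr0_norm// lerNl ltW.
have phi1 : phi 1 <= 0.
  rewrite phiE ?lexx ?ler01// sg1 tau1 leNgt; apply/negP => g0.
  by apply: h1; exists s2, t2; split => //; rewrite gtr0_norm// ltW.
have [||u u01 phiu] := @IVT R phi 0 1 0 ler01.
- exact: continuous_subspaceT.
- by rewrite ge_min le_max phi0 phi1 orbT.
move: u01; rewrite in_itv/= => u01; have [s0 ts] := far _ u01.
apply: h1; exists (sg u), (tau u); split => //.
rewrite -phiE// phiu normr0 mulr_ge0 ?(ltW e0)//.
exact: le_trans (ltW T0) ts.
Qed.

(** Stated with a single integer [n] serving as inverse gap and as additive constant,
    the alternative holds for all large [n], so it can be achieved simultaneously for
    finitely many exponents.  Intervals of bounded length are absorbed in the additive
    constant thanks to the linear growth bound. *)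
Lemma scalar_dichotomy (L c0 : R) : 0 <= L ->
  (forall s t, 0 <= s -> 0 <= t -> b t - b s <= L * `|t - s| + c0) ->
  (forall t s : nat -> R, (forall n, 0 <= t n) -> (forall n, 0 <= s n) ->
    (forall n, n.+1%:R <= t n - s n) ->
    ~ ((t n - s n)^-1 * (b (t n) - b (s n)) @[n --> \oo] --> gamma)) ->
  \forall n \near \oo,
    (forall s t, 0 <= s -> s <= t ->
       b t - b s <= (gamma - n%:R^-1) * (t - s) + n%:R) \/
    (forall s t, 0 <= s -> s <= t ->
       (gamma + n%:R^-1) * (t - s) - n%:R <= b t - b s).
Proof.
move=> L0 bL noseq.
(* Otherwise, for each [n] some interval of length at least [n.+1] has an average
   within [n.+1%:R^-1] of [gamma]. *)
have [N HN] : exists N : nat,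
  (forall s t, 0 <= s -> N.+1%:R <= t - s -> G s t <= - (N.+1%:R^-1 * (t - s))) \/
  (forall s t, 0 <= s -> N.+1%:R <= t - s -> N.+1%:R^-1 * (t - s) <= G s t).
  apply: contrapT => /forallNP H.
  have near_gamma (n : nat) : exists st : R * R,
    [/\ 0 <= st.1, n.+1%:R <= st.2 - st.1 &
      `|G st.1 st.2| <= n.+1%:R^-1 * (st.2 - st.1)].
    have n0 : 0 < n.+1%:R :> R by rewrite ltr0n.
    have [[s [t [h1 h2 h3]]]|h|h] := scalar_alternative n0 (etrans (invr_gt0 _) n0).
    - by exists (s, t).
    - by exfalso; apply: (H n); left.
    - by exfalso; apply: (H n); right.
  have [f Hf] := choice near_gamma.
  apply: (noseq (fun n => (f n).2) (fun n => (f n).1)).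
  - move=> n; have [h1 h2 _] := Hf n.
    by rewrite (le_trans h1)// -subr_ge0 (le_trans _ h2).
  - by move=> n; have [] := Hf n.
  - by move=> n; have [] := Hf n.
  apply/cvgrPdist_le => e e0; near=> n; have [h1 h2 h3] := Hf n.
  set t := (f n).2 in h2 h3 *; set s := (f n).1 in h1 h2 h3 *.
  have ts : 0 < t - s by apply: lt_le_trans h2.
  have -> : gamma - (t - s)^-1 * (b t - b s) = - ((t - s)^-1 * G s t).
    by rewrite /G; field; rewrite gt_eqF.
  rewrite normrN normrM gtr0_norm ?invr_gt0// mulrC ler_pdivrMr//.
  apply: le_trans h3 _; rewrite ler_wpM2r ?(ltW ts)//.
  by near: n; apply: filterS (near_infty_natSinv_lt (PosNum e0)) => n /ltW.
near=> n.
have nN : (N.+1 <= n)%N by near: n; exact: nbhs_infty_ge.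
have n0 : 0 < n%:R :> R by rewrite ltr0n (leq_trans _ nN).
have n1 : n%:R^-1 <= 1 :> R by rewrite invf_le1// ler1n (leq_trans _ nN).
have nNi : n%:R^-1 <= N.+1%:R^-1 :> R by rewrite lef_pV2 ?ler_nat ?posrE ?ltr0Sn.
have nbig : L * N.+1%:R + c0 + (`|gamma| + 1) * N.+1%:R <= n%:R.
  by near: n; exact: nbhs_infty_ger.
(* On intervals shorter than [N.+1] both bounds follow from the growth of [b], as
   [n] exceeds everything that can accumulate there. *)
have short s t : 0 <= s -> s <= t -> t - s < N.+1%:R ->
   (gamma + n%:R^-1) * (t - s) - n%:R <= - (L * (t - s) + c0)
   /\ L * (t - s) + c0 <= (gamma - n%:R^-1) * (t - s) + n%:R.
  move=> s0 st stN; have ts0 : 0 <= t - s by rewrite subr_ge0.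
  have h1 : L * (t - s) <= L * N.+1%:R by rewrite ler_wpM2l// ltW.
  have h2 x : `|x| <= `|gamma| + 1 -> `|x * (t - s)| <= (`|gamma| + 1) * N.+1%:R.
    by move=> hx; rewrite normrM (ger0_norm ts0) ler_pM// ltW.
  have n1' : `|n%:R^-1 : R| <= 1 by rewrite ger0_norm// invr_ge0 ltW.
  have := h2 (gamma + n%:R^-1); have := h2 (gamma - n%:R^-1).
  rewrite (le_trans (ler_normB _ _)) ?lerD2l// (le_trans (ler_normD _ _)) ?lerD2l//.
  move=> /(_ isT); rewrite ler_norml => /andP[h3 h4].
  move=> /(_ isT); rewrite ler_norml => /andP[h5 h6].
  move: h1 h3 h4 h5 h6 nbig; set p := (gamma - _) * _; set q := (gamma + _) * _.
  set u := (`|gamma| + 1) * _; set v := L * (t - s); set w := L * N.+1%:R.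
  by move: p q u v w (n%:R : R) => p q u v w z; split; lra.
case: HN => H; [left|right] => s t s0 st; have t0 := le_trans s0 st;
    have ts0 : 0 <= t - s by rewrite subr_ge0.
  have [far|near] := leP N.+1%:R (t - s).
    have := H s t s0 far; rewrite /G.
    have : n%:R^-1 * (t - s) <= N.+1%:R^-1 * (t - s) by rewrite ler_wpM2r.
    rewrite [(gamma - _) * _]mulrBl.
    set x := n%:R^-1 * (t - s); set y := N.+1%:R^-1 * (t - s).
    by move: (gamma * (t - s)) x y => x y z h1 h2; lra.
  have [_] := short _ _ s0 st near; apply: le_trans.
  by have := bL _ _ s0 t0; rewrite ger0_norm.
have [far|near] := leP N.+1%:R (t - s).
  have := H s t s0 far; rewrite /G.
  have : n%:R^-1 * (t - s) <= N.+1%:R^-1 * (t - s) by rewrite ler_wpM2r.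
  rewrite [(gamma + _) * _]mulrDl.
  set x := n%:R^-1 * (t - s); set y := N.+1%:R^-1 * (t - s).
  by move: (gamma * (t - s)) x y => x y z h1 h2; lra.
have [h _] := short _ _ s0 st near; apply: le_trans h _.
by rewrite lerNl opprB; have := bL _ _ t0 s0; rewrite distrC ger0_norm.
Unshelve. all: by end_near. Qed.

End ScalarAlternative.

(** * The Sacker--Sell spectrum of a diagonalizable system lies in its Bohl spectrum *)

Section DiagonalConverse.
Context {R : realType} (d : nat) (X S : R -> 'M[R]_d) (b : 'I_d -> R -> R) (C K L : R).
Hypothesis cb : forall i, half_cont (b i).
Hypothesis Su : forall t, 0 <= t -> S t \in unitmx.
Hypothesis SC : forall t, 0 <= t -> `|S t| <= C.
Hypothesis SiC : forall t, 0 <= t -> `|invmx (S t)| <= C.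
Hypothesis XE : forall t, 0 <= t ->
  X t = S t *m diag_mx (\row_i expR (b i t)) *m invmx (S 0).
Hypotheses (K1 : 1 <= K) (L0 : 0 <= L).
Hypothesis XL : forall s t, 0 <= s -> 0 <= t ->
    `|X t *m invmx (X s)| <= K * expR (L * `|t - s|).

Let C0 : 0 <= C.
Proof. by apply: le_trans (normr_ge0 _) (SC (lexx 0)). Qed.

Let S0u : S 0 \in unitmx := Su (lexx 0).

Lemma diagonal_form_unit t : 0 <= t -> X t \in unitmx.
Proof.
move=> t0; rewrite XE// !unitmx_mul Su// unitmx_inv S0u andbT/=.
rewrite unitmxE det_diag unitfE; apply/prodf_neq0 => i _.
by rewrite mxE gt_eqF ?expR_gt0.
Qed.

Lemma mx_norm_diag_le (c : 'rV[R]_d) e : 0 <= e -> (forall i, `|c 0 i| <= e) ->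
  `|diag_mx c| <= e.
Proof.
move=> e0 ce; apply/mx_norm_leP => // i j; rewrite mxE.
by case: (i == j); rewrite ?mulr1n// mulr0n normr0.
Qed.

(** Every projector considered is diagonal in the frame [S 0]; the transition matrix
    then stays diagonal up to the bounded changes of frame. *)
Lemma diagonal_transition (c : 'rV[R]_d) s t : 0 <= s -> 0 <= t ->
  X t *m (S 0 *m diag_mx c *m invmx (S 0)) *m invmx (X s) =
  S t *m diag_mx (\row_i (c 0 i * expR (b i t - b i s))) *m invmx (S s).
Proof.
move=> s0 t0; apply: (canLR (mulmxK (diagonal_form_unit s0))).
rewrite !XE// !mulmxA !mulmxKV ?Su//; congr (_ *m _).
rewrite -!mulmxA; congr (_ *m _).
apply/matrixP => i j; rewrite !mul_diag_mx !mxE.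
case: eqVneq => [->|]; last by rewrite !mulr0n !mulr0.
by rewrite !mulr1n -mulrA -expRD subrK mulrC.
Qed.

(** [exp (b_i t - b_i s)] is a diagonal entry of the transition matrix seen in the
    moving frame.  The summand 1 only ensures that the argument of [ln] is positive. *)
Lemma exponent_growth i s t : 0 <= s -> 0 <= t ->
  b i t - b i s <= L * `|t - s| + ln (d%:R * (d%:R * C * K) * C + 1).
Proof.
move=> s0 t0; set Z := _ + 1.
have K0 : 0 <= K by exact: le_trans K1.
have Z0 : 0 < Z by rewrite ltr_wpDl// !mulr_ge0.
rewrite -ler_expR [leRHS]expRD lnK ?posrE// [leRHS]mulrC.
have -> : expR (b i t - b i s) = (invmx (S t) *m (X t *m invmx (X s)) *m S s) i i.
  have := diagonal_transition (const_mx 1) s0 t0.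
  rewrite diag_const_mx mulmx1 mulmxV// mulmx1 => ->.
  rewrite !mulmxA mulVmx ?Su// mul1mx mulmxKV ?Su// !mxE eqxx mulr1n mul1r.
  by [].
apply: le_trans (ler_norm _) _; apply: le_trans (mx_entry_le _ _ _) _.
apply: le_trans (mx_norm_mul_le (mx_norm_mul_le (SiC t0) (XL s0 t0)) (SC s0)) _.
rewrite (_ : _ * C = d%:R * (d%:R * C * K) * C * expR (L * `|t - s|)); last by ring.
by rewrite ler_wpM2r ?expR_ge0// lerDl.
Qed.

(** The bounds on [S] and its inverse confine the norm of the [i]-th column of [S t]
    between two positive constants; the summand 1 keeps the upper one positive. *)
Lemma column_norm i t : 0 <= t ->
  exists2 p, (d%:R * C + 1)^-1 <= p <= d%:R * C + 1 &
    `|X t *m (S 0 *m delta_mx i (0 : 'I_1))| = expR (b i t) * p.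
Proof.
move=> t0; set Z := _ + 1.
have Z0 : 0 < Z by rewrite ltr_wpDl// mulr_ge0.
pose e : 'cV[R]_d := delta_mx i 0.
have en : `|e| <= 1.
  apply/mx_norm_leP => // k j; rewrite mxE.
  by case: (_ && _); rewrite ?normr1 ?normr0.
exists (`|S t *m e|).
  apply/andP; split.
    rewrite -div1r ler_pdivrMr//.
    have h : 1 <= `|e|.
      by have := mx_entry_le e i 0; rewrite mxE !eqxx normr1.
    apply: le_trans h _; rewrite -{1}(mulKmx (Su t0) e).
    apply: le_trans (mx_norm_mul_le (SiC t0) (lexx _)) _.
    by rewrite mulrC ler_wpM2l// lerDl.
  apply: le_trans (mx_norm_mul_le (SC t0) en) _.
  by rewrite mulr1 lerDl.
have -> : X t *m (S 0 *m e) = expR (b i t) *: (S t *m e).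
  rewrite XE// !mulmxA mulmxKV ?S0u// -mulmxA scalemxAr; congr (_ *m _).
  apply/matrixP => k j; rewrite mul_diag_mx !mxE.
  by case: eqVneq => [->|] //=; rewrite !mulr0.
by rewrite mx_normZ ger0_norm ?expR_ge0.
Qed.

(** The logarithm of the bounded factor from [column_norm] is divided by [t - s],
    hence does not contribute to the limit. *)
Lemma exponent_limit_in_Bohl i gamma (t s : nat -> R) :
  (forall n, 0 <= t n) -> (forall n, 0 <= s n) ->
  (forall n, n.+1%:R <= t n - s n) ->
  (t n - s n)^-1 * (b i (t n) - b i (s n)) @[n --> \oo] --> gamma ->
  Bohl_spectrum X gamma%:E.
Proof.
move=> t0 s0 ts lim.
have ts0 n : 0 < t n - s n by apply: lt_le_trans (ts n); rewrite ltr0Sn.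
exists (S 0 *m delta_mx i 0).
  apply: unitmx_mul_neq0; first exact: S0u.
  by apply/eqP => /matrixP/(_ i 0)/eqP; rewrite !mxE !eqxx oner_eq0.
exists t, s; split => //.
  apply/cvgryPge => A; near=> n; apply: le_trans (ts n).
  rewrite -natr1 ler_wpDr//; near: n; exact: nbhs_infty_ger.
apply: cvg_EFin; first exact: nearW.
set Z := d%:R * C + 1.
have Z0 : 0 < Z by rewrite ltr_wpDl// mulr_ge0.
have close n : `|(t n - s n)^-1 * ln (`|X (t n) *m (S 0 *m delta_mx i (0 : 'I_1))|
      / `|X (s n) *m (S 0 *m delta_mx i (0 : 'I_1))|)
      - (t n - s n)^-1 * (b i (t n) - b i (s n))| <= 2 * `|ln Z| / n.+1%:R.
  have [p /andP[p1 p2] ->] := column_norm i (t0 n).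
  have [q /andP[q1 q2] ->] := column_norm i (s0 n).
  rewrite -/Z in p1 p2 q1 q2.
  have p0 : 0 < p by apply: lt_le_trans p1; rewrite invr_gt0.
  have q0 : 0 < q by apply: lt_le_trans q1; rewrite invr_gt0.
  have lnb r : 0 < r -> Z^-1 <= r -> r <= Z -> `|ln r| <= `|ln Z|.
    move=> r0 r1 r2; apply: (le_trans _ (ler_norm (ln Z))).
    rewrite ler_norml -lnV ?posrE// !ler_ln ?posrE ?invr_gt0//.
    by rewrite r1 r2.
  rewrite ln_div ?posrE ?mulr_gt0 ?expR_gt0// !lnM ?posrE ?expR_gt0// !expRK.
  have -> : (t n - s n)^-1 * (b i (t n) + ln p - (b i (s n) + ln q)) -
    (t n - s n)^-1 * (b i (t n) - b i (s n)) = (t n - s n)^-1 * (ln p - ln q) by ring.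
  rewrite normrM mulrC (ger0_norm (x := (t n - s n)^-1)) ?invr_ge0 ?(ltW (ts0 n))//.
  apply: ler_pM => //; first by rewrite invr_ge0 ltW.
    apply: le_trans (ler_normB _ _) _.
    by rewrite (_ : 2 * _ = `|ln Z| + `|ln Z|) ?lerD ?lnb//; ring.
  by rewrite lef_pV2 ?posrE ?ltr0Sn.
apply/cvgrPdist_le => e e0; have e20 : 0 < e / 2 by rewrite divr_gt0.
move/cvgrPdist_le/(_ _ e20): lim => lim.
near=> n.
have h1 : `|gamma - (t n - s n)^-1 * (b i (t n) - b i (s n))| <= e / 2 by near: n.
have h2 : 2 * `|ln Z| / n.+1%:R <= e / 2.
  have : 2 * `|ln Z| / (e / 2) <= n%:R by near: n; exact: nbhs_infty_ger.
  rewrite ler_pdivrMr// => h; rewrite ler_pdivrMr ?ltr0Sn// (le_trans h)//.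
  by rewrite mulrC ler_wpM2l ?(ltW e20)// ler_nat.
have := le_trans (close n) h2; move: h1 => /=.
set u := _^-1 * ln _; set v := _^-1 * _.
by rewrite !ler_norml => /andP[? ?] /andP[? ?]; apply/andP; split; lra.
Unshelve. all: by end_near. Qed.

(** The projector selects, in the frame [S 0], the indices whose averages stay below
    [gamma]. *)
Lemma dichotomy_of_not_Bohl gamma : ~ Bohl_spectrum X gamma%:E ->
  exists P, exp_dichotomy_with_projector X gamma P.
Proof.
move=> nB.
pose st (n : nat) i := forall s t, 0 <= s -> s <= t ->
   b i t - b i s <= (gamma - n%:R^-1) * (t - s) + n%:R.
pose un (n : nat) i := forall s t, 0 <= s -> s <= t ->
   (gamma + n%:R^-1) * (t - s) - n%:R <= b i t - b i s.
have alt_i i : \forall n \near \oo, st n i \/ un n i.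
  have growth s t := @exponent_growth i s t.
  have h := scalar_dichotomy (gamma := gamma) (@cb i) L0 growth.
  by apply: h => t s t0 s0 ts lim; apply: nB; exact: exponent_limit_in_Bohl lim.
have alts : \forall n \near \oo, forall i, st n i \/ un n i.
  exact: filter_forall.
near \oo => n.
have n0 : (0 < n)%N by near: n; exact: nbhs_infty_gt.
have alt : forall i, st n i \/ un n i by near: n.
pose c : 'rV[R]_d := \row_i (`[< st n i >])%:R.
exists (S 0 *m diag_mx c *m invmx (S 0)); split.
  rewrite !mulmxA mulmxKV ?S0u//; congr (_ *m _); rewrite -mulmxA; congr (_ *m _).
  apply/matrixP => i j; rewrite mul_diag_mx !mxE.
  by case: (`[< st n i >]); rewrite ?mul1r ?mul0r ?mul0rn.
have PC : 1%:M - S 0 *m diag_mx c *m invmx (S 0) =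
    S 0 *m diag_mx (const_mx 1 - c) *m invmx (S 0).
  by rewrite linearB /= diag_const_mx mulmxBr mulmx1 mulmxBl mulmxV ?S0u.
have step s t (c' : 'rV[R]_d) x : 0 <= s -> 0 <= t ->
    (forall i, `|c' 0 i * expR (b i t - b i s)| <= expR (x + n%:R)) ->
    `|X t *m (S 0 *m diag_mx c' *m invmx (S 0)) *m invmx (X s)| <=
    Num.max 1 (d%:R * (d%:R * C) * C * expR n%:R) * expR x.
  move=> s0 t0 H; rewrite diagonal_transition//.
  apply: (@le_trans _ _ (d%:R * (d%:R * C) * C * expR n%:R * expR x)); last first.
    by rewrite ler_wpM2r ?expR_ge0// le_max lexx orbT.
  have hD : `|diag_mx (\row_i (c' 0 i * expR (b i t - b i s)))| <= expR (x + n%:R).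
    by apply: mx_norm_diag_le => [|i]; [exact: expR_ge0|rewrite mxE].
  apply: le_trans (mx_norm_mul_le (mx_norm_mul_le (SC t0) hD) (SiC s0)) _.
  by rewrite expRD le_eqVlt; apply/orP; left; apply/eqP; ring.
exists (Num.max 1 (d%:R * (d%:R * C) * C * expR n%:R)), n%:R^-1; split.
- by rewrite le_max lexx.
- by rewrite invr_gt0 ltr0n.
- move=> s t s0 st0; have t0 := le_trans s0 st0; apply: step => // i.
  rewrite mxE; case: asboolP => [sti|_]; last by rewrite mul0r normr0 expR_ge0.
  by rewrite mul1r ger0_norm ?expR_ge0// ler_expR; exact: sti.
move=> t s t0 ts; have s0 := le_trans t0 ts; rewrite PC; apply: step => // i.
rewrite !mxE; case: asboolP => [_|nsti]; first by rewrite subrr mul0r normr0 expR_ge0.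
rewrite subr0 mul1r ger0_norm ?expR_ge0// ler_expR.
have [//|uni] := alt i; have := uni _ _ t0 ts; rewrite -(opprB s t) mulrN.
by move: (_ * (s - t)) => z; lra.
Unshelve. all: by end_near. Qed.

(** At an infinite rate the growth bound gives a dichotomy with projector 1 or 0 at
    the finite rates [L + 1] and [- L - 1]. *)
Lemma SackerSell_sub_Bohl_diagonal : SackerSell_spectrum X `<=` Bohl_spectrum X.
Proof.
rewrite /SackerSell_spectrum => -[gamma||] /= nD.
- by apply: contrapT => nB; apply: nD; exact: dichotomy_of_not_Bohl.
- exfalso; apply: nD; exists (L + 1); split; first by rewrite mulmx1.
  exists K, 1; split => // s t s0 st.
    rewrite mulmx1 addrK; have := XL s0 (le_trans s0 st).
    by rewrite ger0_norm ?subr_ge0.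
  rewrite subrr mulmx0 mul0mx normr0 mulr_ge0 ?expR_ge0//; exact: le_trans K1.
- exfalso; apply: nD; exists (- L - 1); split; first by rewrite mul0mx.
  exists K, 1; split => // s t s0 st.
    by rewrite mulmx0 mul0mx normr0 mulr_ge0 ?expR_ge0//; exact: le_trans K1.
  rewrite subr0 mulmx1 subrK; have := XL (le_trans s0 st) s0.
  by rewrite distrC ger0_norm ?subr_ge0// mulNr -mulrN opprB.
Qed.

End DiagonalConverse.

Lemma diagonalizable_spectra (R : realType) d (A X : R -> 'M[R]_d) :
  loc_integrable_mx A -> bounded_mx A -> diagonalizable_system A ->
  is_fundamental_matrix A X ->
  Bohl_spectrum X = SackerSell_spectrum X.
Proof.
move=> iA bA dA fX.
have [S [b [C [cb Su SC SiC XE]]]] := diagonal_form iA bA dA fX.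
have Xu := diagonal_form_unit Su XE.
have [HX _] := fundamental_matrix_solution iA bA fX.
have [K [L [K1 L0 XL]]] := fundamental_matrix_growth bA HX Xu.
apply/seteqP; split; first exact: Bohl_sub_SackerSell.
exact: (SackerSell_sub_Bohl_diagonal cb Su SC SiC XE K1 L0 XL).
Qed.

Lemma one_dimensional_diagonalizable (R : realType) (A : R -> 'M[R]_1) :
  loc_integrable_mx A -> diagonalizable_system A.
Proof.
move=> iA; exists (fun t => row 0 (A t)); split.
  move=> T i j T0; have := iA T 0 j T0.
  congr (_.-integrable _ _); apply/funext => t.
  by rewrite mxE.
exists (fun=> 1%:M), (fun=> 0); split.
- split; last by move=> x; exact: cvg_cst.
  move=> t t0.
  have -> : (fun x : R => (x - t)^-1 *: (1%:M - 1%:M : 'M[R]_1)) = fun=> 0.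
    by apply/funext => x; rewrite subrr scaler0.
  exact: cvg_cst.
- by move=> t _; exact: unitmx1.
- exists 1; split; first exact: num_real.
  by move=> x x1 t _; exact: le_trans (mx_norm1_le _) (ltW x1).
- exists 1; split; first exact: num_real.
  by move=> x x1 t _; rewrite /= invmx1; exact: le_trans (mx_norm1_le _) (ltW x1).
- move=> t _; rewrite mulmx1 mul1mx; apply/matrixP => i j.
  by rewrite !mxE !ord1 eqxx mulr1n subrr.
Qed.

Theorem theorem20 (R : realType) :
  (forall (d : nat) (A X : R -> 'M[R]_d),
     loc_integrable_mx A -> bounded_mx A -> diagonalizable_system A ->
     is_fundamental_matrix A X ->
     Bohl_spectrum X = SackerSell_spectrum X) /\
  (forall A X : R -> 'M[R]_1,
     loc_integrable_mx A -> bounded_mx A ->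
     is_fundamental_matrix A X ->
     Bohl_spectrum X = SackerSell_spectrum X).
Proof.
split=> [d A X|A X iA bA]; first exact: diagonalizable_spectra.
by apply: diagonalizable_spectra => //; exact: one_dimensional_diagonalizable.
Qed.
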